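(* Consider a stochastic click bandit on the item set $[K]$ (with $K$ positions) satisfying Assumptions A1–A5 below, with attraction probabilities $\alpha(1) > \alpha(2) > \dots > \alpha(K) > 0$. Let ${\sf BubbleRank}$ be run for $n$ steps with confidence parameter $\delta \in (0,1)$ and initial base list $\mathcal{R}_0$. Then its expected $n$-step regret satisfies $$R(n) \le 180\, K\, \frac{\chi_{\max}}{\chi_{\min}}\, \frac{K - 1 + 2|\mathcal{V}_0|}{\Delta_{\min}} \log(1/\delta) + \delta^{1/2} K^3 n^2 .$$
   Context: Model. Items are $\mathcal{D} = [K]$; a list $\mathcal{R}$ is an ordering of all $K$ items, $\mathcal{R}(k)$ is the item at position $k$ and $\mathcal{R}^{-1}(i)$ the position of item $i$; $\Pi_K$ denotes the set of such lists. A stochastic click bandit is given by a distribution $P_\alpha$ over attraction vectors in $\{0,1\}^K$ and a distribution $P_\chi$ over examination matrices in $\{0,1\}^{\Pi_K \times [K]}$. At each time $t$, $(\mathbf{A}_t, \mathbf{X}_t)$ is drawn i.i.d. from $P_\alpha \otimes P_\chi$; the learner chooses a list $\mathbf{R}_t$ (depending on the past) and observes clicks $\mathbf{c}_t(k) = \mathbf{X}_t(\mathbf{R}_t, k)\, \mathbf{A}_t(\mathbf{R}_t(k))$ for $k \in [K]$. Let $\alpha = \mathbb{E}[\mathbf{A}_t]$ (attraction probabilities) and $\chi = \mathbb{E}[\mathbf{X}_t]$ ($\chi(\mathcal{R},k)$ is the examination probability of position $k$ in $\mathcal{R}$), and $r(\mathcal{R},\alpha,\chi) = \sum_{k=1}^K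 \chi(\mathcal{R},k)\alpha(\mathcal{R}(k))$. The regret is $R(n) = \sum_{t=1}^n \mathbb{E}[\max_{\mathcal{R} \in \Pi_K} r(\mathcal{R},\alpha,\chi) - r(\mathbf{R}_t,\alpha,\chi)]$. Let $\mathcal{R}^* = (1,\dots,K)$, $\chi_{\max} = \chi(\mathcal{R}^*,1)$, $\chi_{\min} = \chi(\mathcal{R}^*,K)$, $\Delta_{\min} = \min_{k \in [K-1]} (\alpha(k) - \alpha(k+1))$. Assumptions: for all lists $\mathcal{R},\mathcal{R}'$ and positions $k<\ell$: (A1) $r(\mathcal{R},\alpha,\chi) \le r(\mathcal{R}^*,\alpha,\chi)$; (A2) if $\{\mathcal{R}(1),\dots,\mathcal{R}(k-1)\} = \{\mathcal{R}'(1),\dots,\mathcal{R}'(k-1)\}$ then $\chi(\mathcal{R},k) = \chi(\mathcal{R}',k)$; (A3) $\chi(\mathcal{R},k) \ge \chi(\mathcal{R},\ell)$; (A4) if $\mathcal{R}$ and $\mathcal{R}'$ differ only by exchanging the items at positions $k$ and $\ell$, then $\alpha(\mathcal{R}(k)) \le \alpha(\mathcal{R}(\ell)) \iff \chi(\mathcal{R},\ell) \ge \chi(\mathcal{R}',\ell)$; (A5) $\chi(\mathcal{R},k) \ge \chi(\mathcal{R}^*,k)$. Incorrectly-ordered pairs: $\mathcal{V}(\mathcal{R}) = \{(i,j) \in [K]^2 : i<j,\ \mathcal{R}^{-1}(i) > \mathcal{R}^{-1}(j)\}$ and $\mathcal{V}_0 = \mathcal{V}(\mathcal{R}_0)$.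 Algorithm ${\sf BubbleRank}$ (input: initial list $\mathcal{R}_0$, $\delta$, horizon $n$). Set $\mathbf{s}_0(i,j) = \mathbf{n}_0(i,j) = 0$ for all $i,j\in[K]$ and base list $\bar{\mathbf{R}}_1 = \mathcal{R}_0$. For $t = 1,\dots,n$: let $h = t \bmod 2$ and $\mathbf{R}_t \leftarrow \bar{\mathbf{R}}_t$. For each $k = 1,\dots,\lfloor (K-h)/2 \rfloor$, with $i = \mathbf{R}_t(2k-1+h)$, $j = \mathbf{R}_t(2k+h)$: if $\mathbf{s}_{t-1}(i,j) \le 2\sqrt{\mathbf{n}_{t-1}(i,j)\log(1/\delta)}$, exchange the items at positions $2k-1+h$ and $2k+h$ of $\mathbf{R}_t$ with probability $1/2$. Display $\mathbf{R}_t$ and observe $\mathbf{c}_t$. Set $\mathbf{s}_t = \mathbf{s}_{t-1}$, $\mathbf{n}_t = \mathbf{n}_{t-1}$; for each $k = 1,\dots,\lfloor (K-h)/2\rfloor$, with $i = \mathbf{R}_t(2k-1+h)$, $j = \mathbf{R}_t(2k+h)$: if $|\mathbf{c}_t(2k-1+h) - \mathbf{c}_t(2k+h)| = 1$, add $\mathbf{c}_t(2k-1+h) - \mathbf{c}_t(2k+h)$ to $\mathbf{s}_t(i,j)$, add $\mathbf{c}_t(2k+h) - \mathbf{c}_t(2k-1+h)$ to $\mathbf{s}_t(j,i)$, and add $1$ to both $\mathbf{n}_t(i,j)$ and $\mathbf{n}_t(j,i)$. Finally set $\bar{\mathbf{R}}_{t+1} = \bar{\mathbf{R}}_t$ and for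 $k = 1,\dots,K-1$ in order, with $i = \bar{\mathbf{R}}_{t+1}(k)$, $j = \bar{\mathbf{R}}_{t+1}(k+1)$: if $\mathbf{s}_t(j,i) > 2\sqrt{\mathbf{n}_t(j,i)\log(1/\delta)}$, exchange the items at positions $k$ and $k+1$ of $\bar{\mathbf{R}}_{t+1}$. *)

(* Defs.v *)
From HB Require Import structures.
From mathcomp Require Import all_boot all_order all_algebra fingroup perm.
From mathcomp Require Import reals exp.
Set Implicit Arguments. Unset Strict Implicit. Unset Printing Implicit Defensive.
Import Order.TTheory GRing.Theory Num.Theory.
Local Open Scope ring_scope.

(* Items and positions are both 'I_K (0-based: paper's position/item k is
   ordinal k-1).  A list is a permutation L : {perm 'I_K} with
   L k = item displayed at position k, and (L^-1)%g i = position of item i.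
   The optimal list R* = (1,...,K) is the identity permutation 1%g. *)

Section ClickBandit.
Variables (R : realType) (K : nat).

Definition attr_vec := {ffun 'I_K -> bool}.
Definition exam_mat := {ffun {perm 'I_K} * 'I_K -> bool}.
Definition coin_vec := {ffun 'I_K -> bool}.

Definition is_pmf (T : finType) (P : T -> R) :=
  (forall x, 0 <= P x) /\ \sum_(x : T) P x = 1.

Definition alpha (Pa : attr_vec -> R) (i : 'I_K) : R :=
  \sum_(A : attr_vec) Pa A * (A i)%:R.
Definition chi (Pc : exam_mat -> R) (L : {perm 'I_K}) (k : 'I_K) : R :=
  \sum_(X : exam_mat) Pc X * (X (L, k))%:R.

Definition rew (a : 'I_K -> R) (c : {perm 'I_K} -> 'I_K -> R)
  (L : {perm 'I_K}) : R := \sum_(k : 'I_K) c L k * a (L k).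

Definition swap_pos (L : {perm 'I_K}) (x y : 'I_K) : {perm 'I_K} :=
  (tperm x y * L)%g.

Definition opair (p : nat) : option ('I_K * 'I_K) :=
  match (insub p : option 'I_K), (insub p.+1 : option 'I_K) with
  | Some x, Some y => Some (x, y)
  | _, _ => None
  end.

Definition A1 (a : 'I_K -> R) (c : {perm 'I_K} -> 'I_K -> R) :=
  forall L, rew a c L <= rew a c 1%g.
Definition A2 (c : {perm 'I_K} -> 'I_K -> R) :=
  forall (L L' : {perm 'I_K}) (k : 'I_K),
    L @: [set j : 'I_K | (j < k)%N] = L' @: [set j : 'I_K | (j < k)%N] ->
    c L k = c L' k.
Definition A3 (c : {perm 'I_K} -> 'I_K -> R) :=
  forall (L : {perm 'I_K}) (k l : 'I_K), (k < l)%N -> c L l <= c L k.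
Definition A4 (a : 'I_K -> R) (c : {perm 'I_K} -> 'I_K -> R) :=
  forall (L L' : {perm 'I_K}) (k l : 'I_K), (k < l)%N ->
    L' = swap_pos L k l ->
    (a (L k) <= a (L l) <-> c L' l <= c L l).
Definition A5 (c : {perm 'I_K} -> 'I_K -> R) :=
  forall (L : {perm 'I_K}) (k : 'I_K), c 1%g k <= c L k.

Definition chi_max (c : {perm 'I_K} -> 'I_K -> R) : R :=
  if (insub 0%N : option 'I_K) is Some o then c 1%g o else 0.
Definition chi_min (c : {perm 'I_K} -> 'I_K -> R) : R :=
  if (insub K.-1 : option 'I_K) is Some o then c 1%g o else 0.

(* Delta_min = min_{k in [K-1]} (alpha(k) - alpha(k+1)); the neutral value 1
   only matters when K <= 1 (then the bound's numerator K-1+2|V0| is 0). *)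
Definition Delta_min (a : 'I_K -> R) : R :=
  \big[Num.min/1]_(p <- iota 0 K)
     (if opair p is Some (x, y) then a x - a y else 1).

Definition Vset (L : {perm 'I_K}) : {set 'I_K * 'I_K} :=
  [set ij : 'I_K * 'I_K | (ij.1 < ij.2)%N && ((L^-1)%g ij.2 < (L^-1)%g ij.1)%N].

Record bstate := BState {
  st_s : 'I_K -> 'I_K -> int;
  st_n : 'I_K -> 'I_K -> nat;
  st_base : {perm 'I_K} }.

Definition init_state (R0 : {perm 'I_K}) : bstate :=
  BState (fun _ _ => 0) (fun _ _ => 0%N) R0.

Definition ltest (delta : R) (s : int) (m : nat) : bool :=
  s%:~R <= 2 * Num.sqrt (m%:R * ln (delta^-1)).

(* first (0-based) positions of the pairs compared at time t: the paper's
   pairs (2k-1+h, 2k+h), h = t mod 2, become (p, p+1) with p = h mod 2 *)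
Definition pairs (t : nat) : seq nat :=
  [seq p <- iota 0 K | odd p == odd t].

Definition display (delta : R) (st : bstate) (t : nat) (coins : coin_vec)
  : {perm 'I_K} :=
  foldl (fun (L : {perm 'I_K}) (p : nat) =>
    if opair p is Some (x, y) then
      let i := L x in let j := L y in
      if ltest delta (st_s st i j) (st_n st i j) && coins x
      then swap_pos L x y else L
    else L) (st_base st) (pairs t).

Definition upd_stats (L : {perm 'I_K}) (c : 'I_K -> bool)
  (sn : ('I_K -> 'I_K -> int) * ('I_K -> 'I_K -> nat)) (p : nat) :=
  if opair p is Some (x, y) then
    let i := L x in let j := L y in
    if c x != c y then
      let d : int := (c x)%:R - (c y)%:R in
      ((fun u v => sn.1 u v +
          (if (u == i) && (v == j) then d
           else if (u == j) && (v == i) then - d else 0)),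
       (fun u v => (sn.2 u v + ((u == i) && (v == j) || (u == j) && (v == i)))%N))
    else sn
  else sn.

Definition upd_base (delta : R) (s : 'I_K -> 'I_K -> int)
  (m : 'I_K -> 'I_K -> nat) (B : {perm 'I_K}) : {perm 'I_K} :=
  foldl (fun (B : {perm 'I_K}) (p : nat) =>
    if opair p is Some (x, y) then
      let i := B x in let j := B y in
      if ~~ ltest delta (s j i) (m j i) then swap_pos B x y else B
    else B) B (iota 0 K).

Definition step (delta : R) (st : bstate) (t : nat) (coins : coin_vec)
  (A : attr_vec) (X : exam_mat) : bstate :=
  let L := display delta st t coins in
  let c := fun k => X (L, k) && A (L k) in
  let sn := foldl (upd_stats L c) (st_s st, st_n st) (pairs t) in
  BState sn.1 sn.2 (upd_base delta sn.1 sn.2 (st_base st)).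

(* max_L r(L, alpha, chi) (all r values are >= 0, so 0 is a neutral start) *)
Definition opt_rew (a : 'I_K -> R) (c : {perm 'I_K} -> 'I_K -> R) : R :=
  \big[Num.max/0]_(L : {perm 'I_K}) rew a c L.

(* expected regret of steps t, ..., t+m-1 from state st; the randomness at each
   step is: uniform coins, A ~ Pa, X ~ Pc, all independent and fresh. *)
Fixpoint regret_from (Pa : attr_vec -> R) (Pc : exam_mat -> R) (delta : R)
  (m t : nat) (st : bstate) : R :=
  match m with
  | 0%N => 0
  | m'.+1 =>
    \sum_(coins : coin_vec) (2 ^+ K)^-1 *
    \sum_(A : attr_vec) Pa A * \sum_(X : exam_mat) Pc X *
      ((opt_rew (alpha Pa) (chi Pc)
          - rew (alpha Pa) (chi Pc) (display delta st t coins))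
       + regret_from Pa Pc delta m' t.+1 (step delta st t coins A X))
  end.

Definition bubblerank_regret (Pa : attr_vec -> R) (Pc : exam_mat -> R)
  (delta : R) (R0 : {perm 'I_K}) (n : nat) : R :=
  regret_from Pa Pc delta n 1 (init_state R0).

End ClickBandit.

(* Main.v *)
Require Import Defs.
From mathcomp Require Import all_boot all_order all_algebra fingroup perm.
From mathcomp Require Import reals sequences exp.
From mathcomp Require Import zify ring lra.
Set Implicit Arguments. Unset Strict Implicit. Unset Printing Implicit Defensive.
Import Order.TTheory GRing.Theory Num.Theory.
Local Open Scope ring_scope.

(** A potential argument, by induction on the number of remaining rounds.

    A state is good if every score [s(i, j)] with [i] better than [j] is at least
    [D / 2 * n - 2 * sqrt (n L)], where [n] counts the recorded comparisons, [D] is the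
    minimal gap and [L = ln (1 / delta)].  In a good state no pair is resolved the wrong
    way, so by A2-A4 a click on [j] but not on [i] is at most [1 - D] times as likely as
    a click on [i] but not on [j].  Hence [exp (- th * s + (D / 2 * th - 2 * th ^ 2) * n)]
    is a supermartingale, and a sum of such terms over the pairs and over [th] dominates
    the event that the state is not good: this accounts for the [sqrt delta] term.

    In a good state the regret of a round is at most [K * chi_max] times the total gap of
    the unresolved neighbours of the base list, those compared in this round counting
    three times.  Comparing a pair of gap [g] raises its score by at least [chi_min * g]
    in expectation, and an unresolved score is at most [16 L / D].  Every swap of the base
    list removes an inversion and creates at most two new pairs of neighbours, so at most
    [K - 1 + 2 |V_0|] pairs are ever compared and the total increase of the scores is
    bounded.  The unresolved neighbours not compared in this round are compared in the
    next one, unless the base list changes, which costs an inversion. *)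

Section FiniteExpectation.
Variable R : realType.

Section Linearity.
Variables (T : finType) (P : T -> R).

Definition expect (F : T -> R) : R := \sum_(w : T) P w * F w.

Lemma eq_expect F G : F =1 G -> expect F = expect G.
Proof. by move=> eqFG; apply: eq_bigr => w _; rewrite eqFG. Qed.

Lemma expectD F G : expect (fun w => F w + G w) = expect F + expect G.
Proof. by rewrite /expect -big_split; apply: eq_bigr => w _; rewrite mulrDr. Qed.

Lemma expectZ x F : expect (fun w => x * F w) = x * expect F.
Proof. by rewrite /expect mulr_sumr; apply: eq_bigr => w _; rewrite mulrCA. Qed.

Lemma expectB F G : expect (fun w => F w - G w) = expect F - expect G.
Proof. by rewrite /expect -sumrB; apply: eq_bigr => w _; rewrite mulrBr. Qed.

Lemma expect_sum (I : Type) (s : seq I) (Q : pred I) (F : I -> T -> R) :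
  expect (fun w => \sum_(i <- s | Q i) F i w) = \sum_(i <- s | Q i) expect (F i).
Proof.
by rewrite /expect exchange_big; apply: eq_bigr => w _; rewrite mulr_sumr.
Qed.

End Linearity.

Section Positivity.
Variables (T : finType) (P : T -> R).
Hypothesis P_pmf : is_pmf P.
Implicit Types (a b : pred T).

Lemma expect_cst x : expect P (fun=> x) = x.
Proof. by rewrite /expect -mulr_suml P_pmf.2 mul1r. Qed.

Lemma le_expect F G : (forall w, F w <= G w) -> expect P F <= expect P G.
Proof. by move=> leFG; apply: ler_sum => w _; rewrite ler_wpM2l ?P_pmf.1. Qed.

Lemma expect_ge F x : (forall w, x <= F w) -> x <= expect P F.
Proof. by move=> leF; rewrite -(expect_cst x) le_expect. Qed.

Lemma expect_le F x : (forall w, F w <= x) -> expect P F <= x.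
Proof. by move=> leF; rewrite -[leRHS](expect_cst x) le_expect. Qed.

Definition prob a : R := expect P (fun w => (a w)%:R).

Definition prob_diff a b : R := prob (fun w => a w && ~~ b w).

Lemma prob_ge0 a : 0 <= prob a.
Proof. exact: expect_ge. Qed.

Lemma prob_le1 a : prob a <= 1.
Proof. by apply: expect_le => w; rewrite lern1 leq_b1. Qed.

Lemma prob_split a b : prob a = prob_diff a b + prob (fun w => a w && b w).
Proof.
rewrite /prob_diff /prob -expectD; apply: eq_expect => w.
by case: (a w); case: (b w); rewrite /= ?addr0 ?add0r.
Qed.

Lemma prob_capC a b : prob (fun w => a w && b w) = prob (fun w => b w && a w).
Proof. by apply: eq_expect => w; rewrite andbC. Qed.

Lemma prob_diffB a b : prob_diff a b - prob_diff b a = prob a - prob b.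
Proof. by rewrite (prob_split a b) (prob_split b a) prob_capC; lra. Qed.

Lemma prob_diff_le r a b :
  r <= 1 -> prob b <= r * prob a -> prob_diff b a <= r * prob_diff a b.
Proof.
move=> r1; rewrite (prob_split b a) (prob_split a b) prob_capC.
by have := prob_ge0 (fun w => a w && b w); nra.
Qed.

Lemma expect_bool2 (h : bool -> bool -> R) a b :
  h true true = h false false ->
  expect P (fun w => h (a w) (b w)) =
  h false false + (prob_diff a b * (h true false - h false false)
                   + prob_diff b a * (h false true - h false false)).
Proof.
move=> h_diag; rewrite ![prob_diff _ _ * _]mulrC -[in RHS](expect_cst (h false false)).
rewrite /prob_diff /prob -!expectZ -!expectD !expect_cst; apply: eq_expect => w.
by case: (a w); case: (b w); rewrite /= ?h_diag; ring.
Qed.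

End Positivity.

Section ProductLaw.
Variables (S T : finType) (P : S -> R) (Q : T -> R).

Definition prod_law (w : S * T) : R := P w.1 * Q w.2.

Lemma expect_prod_law F :
  expect prod_law F = expect P (fun x => expect Q (fun y => F (x, y))).
Proof.
rewrite /expect; under [RHS]eq_bigr do rewrite mulr_sumr.
by rewrite pair_bigA; apply: eq_bigr => -[x y] _; rewrite mulrA.
Qed.

Lemma prod_law_pmf : is_pmf P -> is_pmf Q -> is_pmf prod_law.
Proof.
move=> P_pmf Q_pmf; split=> [w|]; first by rewrite mulr_ge0 ?P_pmf.1 ?Q_pmf.1.
rewrite -(pair_bigA _ (fun x y => P x * Q y)) /= -P_pmf.2.
by apply: eq_bigr => x _; rewrite -mulr_sumr Q_pmf.2 mulr1.
Qed.

End ProductLaw.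

End FiniteExpectation.

Lemma ler_sum_inj (R : numDomainType) (I J : finType) (P : pred I) (Q : pred J)
    (f : I -> J) (F : I -> R) (G : J -> R) :
  {in P &, injective f} -> (forall x, P x -> Q (f x)) ->
  (forall x, P x -> F x <= G (f x)) -> (forall z, Q z -> 0 <= G z) ->
  \sum_(x | P x) F x <= \sum_(z | Q z) G z.
Proof.
move=> f_inj PQ leFG G_ge0; apply: le_trans (ler_sum _ leFG) _.
rewrite -(big_imset _ f_inj) /= [leRHS](bigID [in f @: P]) /=.
rewrite (eq_bigl (fun z => Q z && (z \in f @: P))); last first.
  move=> z; rewrite andbC; case: imsetP => //= -[x Px ->].
  by rewrite PQ.
by rewrite lerDl sumr_ge0 // => z /andP[/G_ge0].
Qed.

Section DampedScore.
Variable R : realType.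
Implicit Types (cap : nat) (w p r : R) (s : int).

(* Above [cap] the increments decay geometrically: the damped score stays bounded,
   and a walk whose down-steps are [w] times less likely than its up-steps keeps a
   non-negative drift. *)
Definition damped cap w s : R :=
  if s - cap%:Z is Posz k then cap%:R + \sum_(l < k) w ^+ l else s%:~R.

Definition damped_incr cap w s : R :=
  if s - cap%:Z is Posz k then w ^+ k else 1.

Lemma damped_succ cap w s : damped cap w (s + 1) = damped cap w s + damped_incr cap w s.
Proof.
rewrite /damped /damped_incr (_ : s + 1 - cap%:Z = (s - cap%:Z) + 1); last by lia.
case def_k: (s - cap%:Z) => [k|[|k]].
- by rewrite (_ : Posz k + 1 = Posz k.+1) ?big_ord_recr ?addrA //=; lia.
- have -> : s = cap%:Z - 1 by lia.
  by rewrite (_ : Negz 0 + 1 = Posz 0) // big_ord0 rmorphB /= addr0 subrK.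
- by rewrite (_ : Negz k.+1 + 1 = Negz k) ?rmorphD //; lia.
Qed.

Lemma damped_pred cap w s :
  damped cap w (s - 1) = damped cap w s - damped_incr cap w (s - 1).
Proof. by rewrite -{2}[s](subrK 1) damped_succ addrK. Qed.

Lemma damped0 cap w : damped cap w 0 = 0.
Proof.
rewrite /damped sub0r; case: cap => [|cap]; last by rewrite -NegzE.
by rewrite (_ : - 0%:Z = Posz 0) // big_ord0 addr0.
Qed.

Lemma damped_le cap w s : 0 <= w < 1 -> damped cap w s <= cap%:R + (1 - w)^-1.
Proof.
case/andP=> w_ge0 w_lt1; have w1 : 0 < 1 - w by rewrite subr_gt0.
rewrite /damped; case def_k: (s - cap%:Z) => [k|k].
  rewrite lerD2l -(ler_pM2l w1) mulfV ?gt_eqF //.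
  by rewrite -opprB mulNr -subrX1 opprB gerBl exprn_ge0.
have s_le : s%:~R <= cap%:R :> R by rewrite -[cap%:R]/(cap%:Z%:~R) ler_int; lia.
by apply: le_trans s_le _; rewrite lerDl invr_ge0 ltW.
Qed.

Lemma damped_drift_ge0 cap w s p r : 0 <= w <= 1 -> 0 <= p -> r <= w * p ->
  0 <= p * (damped cap w (s + 1) - damped cap w s)
       + r * (damped cap w (s - 1) - damped cap w s).
Proof.
case/andP=> w_ge0 w_le1 p_ge0 r_le; rewrite damped_succ damped_pred.
set up := damped_incr cap w s; set down := damped_incr cap w (s - 1).
have [down_ge0 down_up] : 0 <= down /\ w * down <= up.
  rewrite /up /down /damped_incr (_ : s - 1 - cap%:Z = (s - cap%:Z) - 1); last by lia.
  case: (s - cap%:Z) => [[|k]|k]; rewrite ?mulr1 ?ler01 //.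
  by rewrite (_ : Posz k.+1 - 1 = Posz k) -?exprS ?exprn_ge0 //; lia.
have : r * down <= w * p * down by rewrite ler_wpM2r.
by have := ler_wpM2l p_ge0 down_up; lra.
Qed.

Lemma damped_drift_linear cap w s p r : s <= cap%:Z ->
  p * (damped cap w (s + 1) - damped cap w s)
  + r * (damped cap w (s - 1) - damped cap w s) = p - r.
Proof.
move=> s_le; have incr1 z : z <= s -> damped_incr cap w z = 1.
  by move=> z_le; rewrite /damped_incr; case def_k: (z - _) => [[|k]|k] //; lia.
by rewrite damped_succ damped_pred !incr1 ?gerBl //; ring.
Qed.

End DampedScore.

Section TiltedScore.
Variable R : realType.
Implicit Types (D L th s n p r : R).

Lemma expR_le_quadratic x : x <= 2^-1 -> expR x <= 1 + x + 2 * x ^+ 2 :> R.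
Proof.
move=> x_le; have x1 : 0 < 1 - x by lra.
have expR_le : expR x * (1 - x) <= 1.
  by rewrite -[leRHS](expRxMexpNx_1 x) ler_wpM2l ?expR_ge0 ?expR_ge1Dx.
rewrite -(ler_pM2r x1); apply: le_trans expR_le _.
have : 0 <= x ^+ 2 * (1 - 2 * x) by rewrite mulr_ge0 ?sqr_ge0 //; lra.
by rewrite expr2; nra.
Qed.

Definition tilted D th s n : R :=
  expR (- th * s + (D / 2 * th - 2 * th ^+ 2) * n).

Lemma tilted_ge0 D th s n : 0 <= tilted D th s n.
Proof. exact: expR_ge0. Qed.

Lemma tilted_drift_le0 D th s n p r :
  0 <= D -> 0 <= th <= 2^-1 -> 0 <= p -> 0 <= r -> r <= (1 - D) * p ->
  p * (tilted D th (s + 1) (n + 1) - tilted D th s n)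
  + r * (tilted D th (s - 1) (n + 1) - tilted D th s n) <= 0.
Proof.
move=> D_ge0 /andP[th_ge0 th_le] p_ge0 r_ge0 r_le.
set ka := D / 2 * th - 2 * th ^+ 2; set z := tilted D th s n.
have tiltedS e : tilted D th (s + e) (n + 1) = z * (expR ka * expR (- th * e)).
  by rewrite -!expRD; congr expR; rewrite /ka; ring.
rewrite !tiltedS mulr1 mulrN1 opprK.
suff : expR ka * (p * expR (- th) + r * expR th) <= p + r.
  by have := tilted_ge0 D th s n; rewrite -/z; nra.
rewrite -ler_pdivlMl ?expR_gt0 // mulrC -expRN.
have expN : expR (- th) <= 1 - th + 2 * th ^+ 2.
  by rewrite -[th ^+ 2]sqrrN expR_le_quadratic; lra.
have expP := expR_le_quadratic th_le.
have ka_le : 1 - ka <= expR (- ka) by exact: expR_ge1Dx.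
have drift : 0 <= th * (p - r - D / 2 * (p + r)).
  have : D * r <= D * p by rewrite ler_wpM2l //; nra.
  by move=> Dr_le; rewrite mulr_ge0 //; lra.
have := ler_wpM2l p_ge0 expN; have := ler_wpM2l r_ge0 expP.
have := ler_wpM2l (addr_ge0 p_ge0 r_ge0) ka_le; rewrite /ka; lra.
Qed.

Definition in_band D L s n : bool := D / 2 * n - 2 * Num.sqrt (n * L) <= s.

Lemma in_band_sqrt_le D L s n : 0 < D -> 0 <= L -> 0 <= n ->
  in_band D L s n -> s <= 2 * Num.sqrt (n * L) -> s <= 16 * L / D.
Proof.
rewrite /in_band => D_gt0 L_ge0 n_ge0; set q := Num.sqrt (n * L) => band s_le.
have q_ge0 : 0 <= q by exact: sqrtr_ge0.
have sqr_q : q ^+ 2 = n * L by rewrite sqr_sqrtr ?mulr_ge0.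
rewrite ler_pdivlMr //; apply: (@le_trans _ _ (2 * q * D)).
  by rewrite ler_wpM2r // ltW.
suff : q * D <= 8 * L by lra.
have Dn_le : D * n <= 8 * q by lra.
have : q * (q * D) <= q * (8 * L).
  by have := ler_wpM2r L_ge0 Dn_le; rewrite -mulrA -sqr_q; lra.
move: q_ge0; rewrite le_eqVlt => /predU1P[<- _|q_gt0]; last by rewrite ler_pM2l.
by rewrite mul0r mulr_ge0.
Qed.

(* The tilt that maximises the exponent of [tilted] at the edge of the band, cut off where
   [expR_le_quadratic] ceases to apply. *)
Definition tilt L n : R := Num.min 1 (Num.sqrt (L / n)) / 2.

Lemma tilt_itv L n : 0 <= tilt L n <= 2^-1.
Proof.
rewrite /tilt divr_ge0 ?le_min ?ler01 ?sqrtr_ge0 //=.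
by rewrite ler_piMl ?invr_ge0 // ge_min lexx.
Qed.

Lemma out_band_count_ge D L s n :
  0 <= D <= 1 -> 0 < L -> 0 <= n -> - n <= s -> ~~ in_band D L s n -> L <= n.
Proof.
case/andP=> D_ge0 D_le1 L_gt0 n_ge0 s_ge; rewrite /in_band -ltNge => s_lt.
rewrite leNgt; apply/negP => nL.
have : n <= Num.sqrt (n * L).
  by rewrite -[leLHS](ger0_norm n_ge0) -sqrtr_sqr expr2 ler_wsqrtr // ler_wpM2l // ltW.
have : D * n <= n by rewrite ler_piMl.
by lra.
Qed.

Lemma tilted_out_band D L s n :
  0 <= D <= 1 -> 0 < L -> 0 <= n -> - n <= s -> ~~ in_band D L s n ->
  expR (L / 2) <= tilted D (tilt L n) s n.
Proof.
move=> D01 L_gt0 n_ge0 s_ge out.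
have Ln : L <= n by exact: out_band_count_ge out.
have n_gt0 : 0 < n by exact: lt_le_trans Ln.
have tiltE : tilt L n = Num.sqrt (L / n) / 2.
  by rewrite /tilt min_r // -[leRHS]sqrtr1 ler_wsqrtr // ler_pdivrMr // mul1r.
have tilt_sqrt : tilt L n * Num.sqrt (n * L) = L / 2.
  rewrite tiltE mulrAC -sqrtrM ?divr_ge0 ?ltW //; congr (_ / _).
  by rewrite mulrA divfK ?gt_eqF // -expr2 sqrtr_sqr ger0_norm // ltW.
have sqr_tilt : tilt L n ^+ 2 * n = L / 4.
  rewrite tiltE expr_div_n sqr_sqrtr ?divr_ge0 ?ltW //.
  by field; rewrite gt_eqF.
have /andP[tilt_ge0 _] := tilt_itv L n.
rewrite ler_expR mulrBl -[2 * _ * _]mulrA sqr_tilt.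
have : tilt L n * s <= tilt L n * (D / 2 * n - 2 * Num.sqrt (n * L)).
  by rewrite ler_wpM2l // ltW // ltNge.
by rewrite mulrBr [tilt L n * (2 * _)]mulrCA tilt_sqrt; lra.
Qed.

End TiltedScore.

Section AdjacentSwaps.
Variable K : nat.
Implicit Types (L : {perm 'I_K}) (x y z u : 'I_K) (p t : nat) (ps : seq nat).

Definition pos L u : 'I_K := (L^-1)%g u.

Lemma posK L : cancel (pos L) L.
Proof. exact: permKV. Qed.

Lemma permK_pos L : cancel L (pos L).
Proof. exact: permK. Qed.

Lemma pos_eq L u x : L x = u -> pos L u = x.
Proof. by move=> <-; rewrite permK_pos. Qed.

Lemma eq_pos L u x : (u == L x) = (pos L u == x).
Proof. by rewrite -{1}(posK L u) (inj_eq perm_inj). Qed.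

Lemma swap_posL L x y : swap_pos L x y x = L y.
Proof. by rewrite permM tpermL. Qed.

Lemma swap_posR L x y : swap_pos L x y y = L x.
Proof. by rewrite permM tpermR. Qed.

Lemma swap_posD L x y z : z != x -> z != y -> swap_pos L x y z = L z.
Proof. by move=> zx zy; rewrite permM tpermD // eq_sym. Qed.

Lemma swap_posK L x y : swap_pos (swap_pos L x y) x y = L.
Proof. by apply/permP => z; rewrite !permM tpermK. Qed.

Lemma pos_swap L x y u : pos (swap_pos L x y) u = tperm x y (pos L u).
Proof. by rewrite /pos /swap_pos invMg tpermV permM. Qed.

(* Past either end of the list, the neighbour of a position is the position itself. *)
Definition next_pos x : 'I_K := insubd x x.+1.
Definition prev_pos x : 'I_K := insubd x x.-1.

Lemma next_posE x : next_pos x = (if x.+1 < K then x.+1 else x)%N :> nat.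
Proof. exact: val_insubd. Qed.

Lemma prev_posE x : prev_pos x = x.-1 :> nat.
Proof. by rewrite val_insubd; case: ifP => //; have := ltn_ord x; lia. Qed.

Lemma next_pos_eq x y : y = x.+1 :> nat -> next_pos x = y.
Proof. by move=> ey; apply: val_inj; rewrite /= next_posE -ey ltn_ord. Qed.

Lemma next_pos_last x : (K <= x.+1)%N -> next_pos x = x.
Proof. by move=> x_last; apply: val_inj; rewrite /= next_posE ltnNge x_last. Qed.

Lemma card_inner_pos : #|[set x : 'I_K | (x.+1 < K)%N]| = K.-1.
Proof.
case: K => [|n]; first by rewrite eq_card0 // => -[].
rewrite (_ : [set _ | _] = [set~ ord_max]) ?cardsC1 ?card_ord //.
by apply/setP => x; rewrite !inE -val_eqE ltnS ltn_neqAle -ltnS ltn_ord andbT.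
Qed.

Variant opair_spec p : option ('I_K * 'I_K) -> Type :=
  | OpairSome x y of x = p :> nat & y = p.+1 :> nat : opair_spec p (Some (x, y))
  | OpairNone of (K <= p.+1)%N : opair_spec p None.

Lemma opairP p : opair_spec p (opair K p).
Proof.
rewrite /opair; case: insubP => [x _ ex|]; last first.
  by rewrite -leqNgt => Kp; constructor; exact: leqW.
by case: insubP => [y _ ey|]; [constructor|rewrite -leqNgt; constructor].
Qed.

Section SwapPass.
Variable sw : {perm 'I_K} -> 'I_K -> 'I_K -> bool.

Definition swap_step L p : {perm 'I_K} :=
  if opair K p is Some (x, y) then if sw L x y then swap_pos L x y else L else L.

Definition swap_pass ps L : {perm 'I_K} := foldl swap_step L ps.

Variant swap_step_spec L p : {perm 'I_K} -> Type :=
  | SwapStep x y of x = p :> nat & y = p.+1 :> nat & sw L x y :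
      swap_step_spec L p (swap_pos L x y)
  | StayStep of (forall x y, x = p :> nat -> y = p.+1 :> nat -> ~~ sw L x y) :
      swap_step_spec L p L.

Lemma swap_stepP L p : swap_step_spec L p (swap_step L p).
Proof.
rewrite /swap_step; case: opairP => [x y ex ey|Kp]; last first.
  by apply: StayStep => x y _ ey; have := ltn_ord y; rewrite ey ltnNge Kp.
case: ifP => [|/negbT] sw_xy; first exact: SwapStep ex ey sw_xy.
apply: StayStep => x' y' ex' ey'.
have -> : x' = x by apply: val_inj; rewrite /= ex' ex.
by have -> : y' = y by apply: val_inj; rewrite /= ey' ey.
Qed.

Lemma swap_pass_out ps L z :
  (forall p, p \in ps -> (p.+1 < K)%N -> (z != p :> nat) && (z != p.+1 :> nat)) ->
  swap_pass ps L z = L z.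
Proof.
elim: ps L => //= p ps IH L out; rewrite [LHS]IH; last first.
  by move=> q q_ps; apply: out; rewrite inE q_ps orbT.
case: swap_stepP => // x y ex ey _.
have := out p (mem_head _ _); rewrite -ey ltn_ord -ex => /(_ isT)/andP[zx zy].
by rewrite swap_posD.
Qed.

Lemma swap_pass_pair ps L x y :
  (forall L1 L2, L1 x = L2 x -> L1 y = L2 y -> sw L1 x y = sw L2 x y) ->
  y = x.+1 :> nat -> uniq ps -> {in ps, forall p, odd p = odd x} ->
  (x : nat) \in ps ->
  swap_pass ps L x = (if sw L x y then L y else L x) /\
  swap_pass ps L y = (if sw L x y then L x else L y).
Proof.
move=> sw_local ey uniq_ps odd_ps x_ps.
case/splitPr: x_ps uniq_ps odd_ps => ps1 ps2; rewrite uniq_catC /= mem_cat negb_or.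
case/andP=> /andP[x_ps2 x_ps1] _ odd_ps.
have away p z : p \in ps1 ++ ps2 -> z \in [:: x; y] ->
    (z != p :> nat) && (z != p.+1 :> nat).
  move=> p_ps z_xy; have p_odd : odd p = odd x.
    by apply: odd_ps; move: p_ps; rewrite !mem_cat inE orbCA => ->; rewrite orbT.
  have px : p != x.
    by apply: contraTneq p_ps => ->; rewrite mem_cat negb_or x_ps1.
  by move: z_xy; rewrite !inE => /orP[]/eqP->; lia.
have out rs L' z : {subset rs <= ps1 ++ ps2} -> z \in [:: x; y] ->
    swap_pass rs L' z = L' z.
  by move=> sub z_xy; apply: swap_pass_out => p /sub p_ps _; exact: away.
have out1 := out ps1 _ _ (mem_subseq (prefix_subseq _ _)).
have out2 := out ps2 _ _ (mem_subseq (suffix_subseq _ _)).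
have [x_in y_in] : x \in [:: x; y] /\ y \in [:: x; y] by rewrite !inE !eqxx orbT.
rewrite /swap_pass foldl_cat /= -!/(swap_pass _ _) !out2 //.
rewrite -(sw_local _ L (out1 L x x_in) (out1 L y y_in)) -(out1 L x) // -(out1 L y) //.
case: swap_stepP => [x' y' ex' ey' sw_xy|stay]; last first.
  by rewrite (negbTE (stay x y erefl ey)).
have <- : x' = x by exact: val_inj.
have <- : y' = y by apply: val_inj; rewrite /= ey' ey.
by rewrite sw_xy swap_posL swap_posR.
Qed.

End SwapPass.

Definition paired t (a b : nat) : bool :=
  (b == a.+1) && (odd a == odd t) || (a == b.+1) && (odd b == odd t).

Lemma pairedC t a b : paired t a b = paired t b a.
Proof. exact: orbC. Qed.

Definition adjacent (a b : nat) : bool := (b == a.+1) || (a == b.+1).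

Lemma paired_adjacent t a b : paired t a b -> adjacent a b.
Proof. by rewrite /paired /adjacent => /orP[]/andP[-> _]; rewrite ?orbT. Qed.

Lemma mem_pairs t z : ((z : nat) \in pairs K t) = (odd z == odd t).
Proof. by rewrite mem_filter mem_iota /= add0n ltn_ord andbT. Qed.

Definition pair_first t x : bool := (odd x == odd t) && (x.+1 < K)%N.
Definition pair_second t y : bool := (odd y != odd t) && (0 < y)%N.

Lemma pair_firstP t x :
  pair_first t x -> next_pos x = x.+1 :> nat /\ odd x == odd t.
Proof. by case/andP=> odd_x xK; rewrite next_posE xK. Qed.

Lemma pair_secondP t y :
  pair_second t y -> y = (prev_pos y).+1 :> nat /\ odd (prev_pos y) == odd t.
Proof. by case/andP=> odd_y y0; rewrite prev_posE; split; lia. Qed.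

Lemma pair_second_next t x : pair_first t x -> pair_second t (next_pos x).
Proof. by case/pair_firstP=> ex odd_x; rewrite /pair_second ex; lia. Qed.

Lemma prev_posK t y : pair_second t y -> next_pos (prev_pos y) = y.
Proof. by case/pair_secondP => ey _; exact: next_pos_eq. Qed.

Lemma next_posK t x : pair_first t x -> prev_pos (next_pos x) = x.
Proof. by case/pair_firstP => ex _; apply: val_inj; rewrite /= prev_posE ex. Qed.

Lemma pair_first_prev t y : pair_second t y -> pair_first t (prev_pos y).
Proof. by case/pair_secondP => ey odd_y; rewrite /pair_first odd_y -ey ltn_ord. Qed.

Lemma sum_round (R : nmodType) t (F : 'I_K -> R) :
  \sum_z F z = \sum_(x | pair_first t x) (F x + F (next_pos x))
             + \sum_(z | ~~ pair_first t z && ~~ pair_second t z) F z.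
Proof.
rewrite (bigID (pair_first t)) big_split /= -!addrA; congr (_ + _).
rewrite (bigID (pair_second t)) /=; congr (_ + _).
rewrite [RHS](reindex_onto prev_pos next_pos) => [|x]; last exact: next_posK.
apply: eq_big => [y|y /andP[_ snd_y]]; last by rewrite (prev_posK snd_y).
apply/andP/andP => [[_ snd_y]|[/pair_second_next snd_y /eqP eq_y]].
  by rewrite pair_first_prev // (prev_posK snd_y).
rewrite eq_y in snd_y; split=> //; move: snd_y; rewrite /pair_first /pair_second; lia.
Qed.

End AdjacentSwaps.

Section ClickStatistics.
Variable K : nat.
Implicit Types (L : {perm 'I_K}) (clk : 'I_K -> bool) (u v : 'I_K) (p t : nat).

Definition pair_at p (a b : nat) : bool :=
  (a == p) && (b == p.+1) || (b == p) && (a == p.+1).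

Lemma count_pair_at t (a b : 'I_K) :
  count (fun p => pair_at p a b) (pairs K t) = paired t a b.
Proof.
have count_pairs (z : 'I_K) : count_mem (z : nat) (pairs K t) = (odd z == odd t).
  by rewrite count_uniq_mem ?mem_pairs ?filter_uniq ?iota_uniq.
case: (eqVneq (b : nat) a.+1) => [eb|nb].
  rewrite (eq_count (a2 := pred1 (a : nat))) ?count_pairs; last first.
    by move=> p; rewrite /pair_at /=; lia.
  by congr nat_of_bool; rewrite /paired; lia.
case: (eqVneq (a : nat) b.+1) => [ea|na].
  rewrite (eq_count (a2 := pred1 (b : nat))) ?count_pairs; last first.
    by move=> p; rewrite /pair_at /=; lia.
  by congr nat_of_bool; rewrite /paired; lia.
rewrite (eq_count (a2 := pred0)) ?count_pred0 /paired ?(negbTE nb) ?(negbTE na) //.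
by move=> p; apply/negbTE; rewrite /pair_at; lia.
Qed.

Lemma upd_statsE L clk sn p u v :
  let k := pair_at p (pos L u) (pos L v) in
  let cu := clk (pos L u) in let cv := clk (pos L v) in
  (upd_stats L clk sn p).1 u v = sn.1 u v + ((cu%:R : int) - cv%:R) *+ k /\
  (upd_stats L clk sn p).2 u v = (sn.2 u v + (cu != cv) * k)%N.
Proof.
rewrite /upd_stats; case: opairP => [x y ex ey|Kp] /=; last first.
  rewrite (_ : pair_at _ _ _ = false) ?muln0 ?addr0 ?addn0 //.
  have := ltn_ord (pos L u); have := ltn_ord (pos L v).
  by rewrite /pair_at; lia.
have -> : pair_at p (pos L u) (pos L v) =
    (u == L x) && (v == L y) || (u == L y) && (v == L x).
  by rewrite !eq_pos -!val_eqE /= ex ey /pair_at [in X in _ || X]andbC.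
case: ifP => [|/negbFE/eqP] clk_xy /=; rewrite !eq_pos.
  case: (boolP (_ && _)) => [/andP[/eqP-> /eqP->]|_] /=; first by rewrite clk_xy.
  case: ifP => [/andP[/eqP-> /eqP->]|_]; last by rewrite muln0.
  by rewrite eq_sym clk_xy opprB.
case: (boolP (_ || _)) => [/orP[]/andP[/eqP-> /eqP->]|_]; last by rewrite muln0 addn0 addr0.
  by rewrite clk_xy subrr eqxx addr0 addn0.
by rewrite clk_xy subrr eqxx addr0 addn0.
Qed.

Lemma foldl_upd_stats L clk sn ps u v :
  let k := count (fun p => pair_at p (pos L u) (pos L v)) ps in
  let cu := clk (pos L u) in let cv := clk (pos L v) in
  (foldl (upd_stats L clk) sn ps).1 u v = sn.1 u v + ((cu%:R : int) - cv%:R) *+ k /\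
  (foldl (upd_stats L clk) sn ps).2 u v = (sn.2 u v + (cu != cv) * k)%N.
Proof.
elim: ps sn => [|p ps IH] sn /=; first by rewrite mulr0n muln0 addr0 addn0.
have [-> ->] := IH (upd_stats L clk sn p).
have [-> ->] := upd_statsE L clk sn p u v.
by rewrite mulrnDr mulnDr addrA addnA.
Qed.

End ClickStatistics.

Section Inversions.
Variable K : nat.
Implicit Types (B : {perm 'I_K}) (x y z u v i j : 'I_K) (m : 'I_K -> 'I_K -> nat).

Lemma mem_Vset B i j : ((i, j) \in Vset B) = (i < j)%N && (pos B j < pos B i)%N.
Proof. by rewrite inE. Qed.

Lemma Vset_swap B x y : y = x.+1 :> nat -> (B y < B x)%N ->
  (#|Vset (swap_pos B x y)| < #|Vset B|)%N.
Proof.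
move=> ey inv_xy; apply: proper_card; apply/properP; split; last first.
  exists (B y, B x); rewrite mem_Vset ?pos_swap !permK_pos inv_xy ?ey //=.
  by rewrite tpermL tpermR ey -leqNgt leqnSn.
apply/subsetP => -[i j]; rewrite !mem_Vset !pos_swap => /andP[ij].
have neq_nat z w : z <> w -> z <> w :> nat by move=> neq_zw /val_inj.
rewrite ij /=; case: tpermP => [pj|pj|/neq_nat jx /neq_nat jy];
  case: tpermP => [pi|pi|/neq_nat ix /neq_nat iy]; rewrite ?pi ?pj; try lia.
by move: ij; rewrite -(posK B i) -(posK B j) pi pj; lia.
Qed.

Definition ordered u v : 'I_K * 'I_K := if (u < v)%N then (u, v) else (v, u).

Lemma ordered_lt u v : (u < v)%N -> ordered u v = (u, v).
Proof. by rewrite /ordered => ->. Qed.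

Lemma orderedC u v : ordered u v = ordered v u.
Proof. by rewrite /ordered; case: ltngtP => // /val_inj->. Qed.

Definition neighbours B x : 'I_K * 'I_K := ordered (B x) (B (next_pos x)).

Lemma neighboursE B x : (x.+1 < K)%N ->
  ((neighbours B x).1 < (neighbours B x).2)%N /\
  (neighbours B x = (B x, B (next_pos x)) \/ neighbours B x = (B (next_pos x), B x)).
Proof.
move=> xK; rewrite /neighbours /ordered; case: (ltngtP (B x)) => [? | ? | /val_inj eqB].
- by split=> //; left.
- by split=> //; right.
- by have /(congr1 val) := perm_inj eqB; rewrite /= next_posE xK => /eqP; rewrite ltn_eqF.
Qed.

Lemma neighbours_inj B : {in [pred x : 'I_K | x.+1 < K]%N &, injective (neighbours B)}.
Proof.
move=> x y; rewrite !inE => xK yK eq_nb.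
have [_ nbx] := neighboursE B xK; have [_ nby] := neighboursE B yK.
apply: val_inj; move: nbx nby; rewrite eq_nb => -[]-> [] [] /perm_inj e1 /perm_inj e2;
  have := congr1 val e1; have := congr1 val e2; rewrite /= !next_posE xK yK; lia.
Qed.

Definition seen m B : {set 'I_K * 'I_K} :=
  [set ij : 'I_K * 'I_K | (ij.1 < ij.2)%N && (m ij.1 ij.2 != 0)%N]
  :|: [set neighbours B x | x : 'I_K & (x.+1 < K)%N].

Lemma adjacent_seen m B i j :
  (i < j)%N -> adjacent (pos B i) (pos B j) -> (i, j) \in seen m B.
Proof.
move=> ij adj; rewrite inE; apply/orP; right; apply/imsetP.
case/orP: adj => /eqP e; [exists (pos B i)|exists (pos B j)]; rewrite ?inE -?e //.
  by rewrite /neighbours (next_pos_eq e) !posK ordered_lt.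
by rewrite /neighbours (next_pos_eq e) !posK orderedC ordered_lt.
Qed.

Lemma notin_seen m B i j : (i < j)%N -> (i, j) \notin seen m B ->
  m i j = 0%N /\ ~~ adjacent (pos B i) (pos B j).
Proof.
move=> ij; case: (boolP (adjacent _ _)) => [/(adjacent_seen m ij)-> //|_].
by rewrite inE negb_or inE /= ij negbK => /andP[/eqP].
Qed.

Lemma seen_sub m m' B :
  (forall i j, (i < j)%N -> (i, j) \notin seen m B -> m' i j = 0%N) ->
  seen m' B \subset seen m B.
Proof.
move=> m'0; rewrite subUset subsetUr andbT.
apply/subsetP => -[i j]; rewrite inE /= => /andP[ij].
by apply: contraR => /(m'0 _ _ ij)->.
Qed.

Lemma card_seen0 B : (#|seen (fun _ _ => 0%N) B| <= K.-1)%N.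
Proof.
rewrite -card_inner_pos; apply: leq_trans (leq_imset_card (neighbours B) _).
apply: subset_leq_card; rewrite subUset (_ : [set _ | _] = set0) ?sub0set /=.
  by apply: imsetS; apply/subsetP => x; rewrite inE.
by apply/setP => ij; rewrite !inE andbF.
Qed.

Lemma neighbours_swap B x y z : y = x.+1 :> nat -> z != prev_pos x -> z != y ->
  neighbours (swap_pos B x y) z = neighbours B z.
Proof.
move=> ey; rewrite -!val_eqE /= prev_posE => zx zy; rewrite /neighbours.
case: (eqVneq z x) => [->|].
  by rewrite (next_pos_eq ey) swap_posL swap_posR orderedC.
rewrite -val_eqE /= => neq_zx.
by rewrite !swap_posD // -val_eqE //= next_posE; case: ifP => _; lia.
Qed.

Lemma seen_swap m B x y : y = x.+1 :> nat ->
  (#|seen m (swap_pos B x y)| <= #|seen m B| + 2)%N.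
Proof.
move=> ey; pose new_nb := neighbours (swap_pos B x y).
have sub : seen m (swap_pos B x y) \subset
    seen m B :|: [set new_nb (prev_pos x); new_nb y].
  rewrite subUset; apply/andP; split.
    by rewrite /seen -setUA subsetUl.
  apply/subsetP => _ /imsetP[z zK ->]; rewrite in_setU in_set2.
  case: (eqVneq z (prev_pos x)) => [->|zx]; first by rewrite eqxx orbT.
  case: (eqVneq z y) => [->|zy]; first by rewrite eqxx !orbT.
  by rewrite neighbours_swap // inE imset_f ?orbT.
apply: leq_trans (subset_leq_card sub) _; apply: leq_trans (leq_card_setU _ _) _.
by rewrite leq_add2l cards2; case: (_ != _).
Qed.

Definition budget m B : nat := (#|seen m B| + 2 * #|Vset B|)%N.

Lemma budget_swap m B x y : y = x.+1 :> nat -> (B y < B x)%N ->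
  (budget m (swap_pos B x y) <= budget m B)%N.
Proof.
move=> ey inv_xy; rewrite /budget.
by have := Vset_swap ey inv_xy; have := seen_swap m B ey; lia.
Qed.

Section SortingPass.
Variable sw : {perm 'I_K} -> 'I_K -> 'I_K -> bool.
Hypothesis sw_inv : forall B x y, sw B x y -> (B y < B x)%N.

Lemma budget_swap_pass m ps B : (budget m (swap_pass sw ps B) <= budget m B)%N.
Proof.
elim: ps B => //= p ps IH B; apply: leq_trans (IH _) _.
by case: swap_stepP => // x y ex ey /sw_inv; apply: budget_swap; rewrite ex ey.
Qed.

Lemma Vset_swap_pass ps B :
  (#|Vset (swap_pass sw ps B)| < #|Vset B|)%N \/
  swap_pass sw ps B = B /\
  (forall x y, (x : nat) \in ps -> y = x.+1 :> nat -> ~~ sw B x y).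
Proof.
elim: ps B => [|p ps IH] B; first by right.
rewrite -[swap_pass sw _ B]/(swap_pass sw ps (swap_step sw B p)).
case: swap_stepP => [x y ex ey /sw_inv inv_xy|stay].
  have lt_Vset : (#|Vset (swap_pos B x y)| < #|Vset B|)%N.
    by apply: Vset_swap inv_xy; rewrite ex ey.
  by left; case: (IH (swap_pos B x y)) => [|[-> _]] //; lia.
case: (IH B) => [|[-> still]]; [by left|right; split=> // x y].
rewrite inE => /predU1P[ex ey|]; last exact: still.
by apply: stay; rewrite ?ey ex.
Qed.

End SortingPass.

End Inversions.

Section BubbleRankRound.
Variables (R : realType) (K : nat) (delta : R).
Implicit Types (st : bstate K) (t : nat) (coins : coin_vec K).
Implicit Types (x y z u v i j : 'I_K).

Definition outcome : finType := (coin_vec K * attr_vec K * exam_mat K)%type.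
Implicit Types w : outcome.

Definition unresolved st u v : bool := ltest delta (st_s st u v) (st_n st u v).

Let exchange st coins (L : {perm 'I_K}) x y := unresolved st (L x) (L y) && coins x.

Lemma display_paired st t coins x y : y = x.+1 :> nat -> odd x == odd t ->
  let B := st_base st in let swapped := unresolved st (B x) (B y) && coins x in
  display delta st t coins x = (if swapped then B y else B x) /\
  display delta st t coins y = (if swapped then B x else B y).
Proof.
move=> ey odd_x.
apply: (@swap_pass_pair _ (exchange st coins)) => //.
- by rewrite /exchange => L1 L2 -> ->.
- by rewrite filter_uniq ?iota_uniq.
- by move=> p; rewrite mem_filter => /andP[/eqP-> _]; apply/esym/eqP.
- by rewrite mem_pairs.
Qed.

Lemma display_unpaired st t coins z : ~~ pair_first t z -> ~~ pair_second t z ->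
  display delta st t coins z = st_base st z.
Proof.
rewrite /pair_first /pair_second => not_first not_second.
apply: (swap_pass_out (exchange st coins)) => p.
by rewrite mem_filter => /andP[odd_p _] pK; lia.
Qed.

Lemma display_paired_items st t coins x y : paired t x y ->
  let L := display delta st t coins in let B := st_base st in
  (L x = B x /\ L y = B y) \/ (L x = B y /\ L y = B x).
Proof.
case/orP=> /andP[/eqP e odd_first] /=;
  have [-> ->] := display_paired st coins e odd_first; case: ifP => _;
  by [left|right].
Qed.

Lemma paired_display st t coins u v :
  paired t (pos (display delta st t coins) u) (pos (display delta st t coins) v)
  = paired t (pos (st_base st) u) (pos (st_base st) v).
Proof.
apply/idP/idP => pd; have /= := display_paired_items st coins pd;
  rewrite !posK => -[[eu ev]|[eu ev]].
- by rewrite (pos_eq (esym eu)) (pos_eq (esym ev)).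
- by rewrite (pos_eq (esym eu)) (pos_eq (esym ev)) pairedC.
- by rewrite (pos_eq eu) (pos_eq ev).
- by rewrite (pos_eq eu) (pos_eq ev) pairedC.
Qed.

Definition flip x coins : coin_vec K := [ffun z => (z == x) (+) coins z].

Lemma flipK x : involutive (flip x).
Proof. by move=> coins; apply/ffunP => z; rewrite !ffunE addKb. Qed.

Lemma display_flip st t coins x y :
  y = x.+1 :> nat -> odd x == odd t -> unresolved st (st_base st x) (st_base st y) ->
  display delta st t (flip x coins) = swap_pos (display delta st t coins) x y.
Proof.
move=> ey odd_x unres; apply/permP => z.
have [Lx Ly] := display_paired st coins ey odd_x.
have [Lx' Ly'] := display_paired st (flip x coins) ey odd_x.
rewrite unres ffunE eqxx /= in Lx Ly Lx' Ly'.
case: (eqVneq z x) => [->|zx]; first by rewrite swap_posL Lx' Ly; case: (coins x).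
case: (eqVneq z y) => [->|zy]; first by rewrite swap_posR Ly' Lx; case: (coins x).
have flip_out z' : z' != x -> flip x coins z' = coins z'.
  by move=> neq; rewrite ffunE (negbTE neq).
rewrite swap_posD //.
case: (boolP (pair_first t z)) => [/pair_firstP[e odd_z]|not_first].
  have [-> _] := display_paired st (flip x coins) e odd_z.
  by have [-> _] := display_paired st coins e odd_z; rewrite flip_out.
case: (boolP (pair_second t z)) => [/pair_secondP[e odd_prev]|not_second].
  have [_ ->] := display_paired st (flip x coins) e odd_prev.
  have [_ ->] := display_paired st coins e odd_prev; rewrite flip_out //.
  by apply: contra zy => /eqP prev_x; apply/eqP/val_inj; rewrite /= e prev_x ey.
by rewrite !display_unpaired.
Qed.

Definition next_state st t w : bstate K := step delta st t w.1.1 w.1.2 w.2.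

Definition click st t u w : bool :=
  w.2 (display delta st t w.1.1, pos (display delta st t w.1.1) u) && w.1.2 u.

Lemma next_stats st t w u v :
  let k := paired t (pos (st_base st) u) (pos (st_base st) v) in
  let cu := click st t u w in let cv := click st t v w in
  st_s (next_state st t w) u v = st_s st u v + ((cu%:R : int) - cv%:R) *+ k /\
  st_n (next_state st t w) u v = (st_n st u v + (cu != cv) * k)%N.
Proof.
rewrite /next_state /step /=; set L := display _ _ _ _.
have [-> ->] := foldl_upd_stats L (fun x => w.2 (L, x) && w.1.2 (L x))
  (st_s st, st_n st) (pairs K t) u v.
by rewrite count_pair_at paired_display !posK.
Qed.

Lemma next_count_le st t w u v : (st_n (next_state st t w) u v <= (st_n st u v).+1)%N.
Proof.
have [_ ->] := next_stats st t w u v.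
by rewrite -addn1 leq_add2l; case: (_ != _); case: (paired _ _ _).
Qed.

Definition consistent st : Prop :=
  [/\ forall u v, st_s st v u = - st_s st u v,
      forall u v, st_n st v u = st_n st u v
    & forall u v, st_s st u v <= (st_n st u v)%:Z].

Lemma consistent_init R0 : consistent (init_state R0).
Proof. by split. Qed.

Lemma consistent_next st t w : consistent st -> consistent (next_state st t w).
Proof.
case=> anti sym s_le_n; split=> u v; have [es en] := next_stats st t w u v.
- have [-> _] := next_stats st t w v u.
  rewrite es anti [paired t (pos _ v) _]pairedC.
  by case: (paired _ _ _); rewrite ?mulr0n ?addr0 // opprD opprB.
- have [_ ->] := next_stats st t w v u.
  by rewrite en sym [paired t (pos _ v) _]pairedC eq_sym.
rewrite es en; have := s_le_n u v.
case: (paired _ _ _); last by rewrite mulr0n muln0; lia.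
by case: (click _ _ u w); case: (click _ _ v w) => /=; lia.
Qed.

Lemma consistent_ge st u v : consistent st -> - (st_n st u v)%:Z <= st_s st u v.
Proof. by case=> anti sym s_le_n; rewrite lerNl -anti -sym. Qed.

Lemma consistent_score0 st u v : consistent st -> st_n st u v = 0%N -> st_s st u v = 0.
Proof.
move=> st_ok n0; have := consistent_ge u v st_ok; have [_ _ /(_ u v)] := st_ok.
by rewrite n0; lia.
Qed.

Definition correct st : Prop := forall u v, ~~ unresolved st u v -> (u < v)%N.

(* A single bubble pass may leave resolved neighbours out of order; the next pass
   then removes an inversion unless they fall back to unresolved. *)
Definition pending st : bool :=
  [exists x : 'I_K, ~~ unresolved st (st_base st (next_pos x)) (st_base st x)].

Lemma pending_init R0 : pending (init_state R0) = false.
Proof.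
apply/negbTE; rewrite negb_exists; apply/forallP => x; rewrite negbK.
by rewrite /unresolved /ltest mul0r sqrtr0 mulr0.
Qed.

Lemma unseen_next st t w i j : (i < j)%N ->
  (i, j) \notin seen (st_n st) (st_base st) -> st_n (next_state st t w) i j = 0%N.
Proof.
move=> ij /(notin_seen ij)[n0 not_adj]; have [_ ->] := next_stats st t w i j.
by rewrite n0 (contraNF (@paired_adjacent t _ _) not_adj) muln0.
Qed.

Definition state_budget st : nat := budget (st_n st) (st_base st).

Let misplaced st B x y := ~~ unresolved st (B y : 'I_K) (B x).

Lemma next_baseE st t w : st_base (next_state st t w) =
  swap_pass (misplaced (next_state st t w)) (iota 0 K) (st_base st).
Proof. by []. Qed.

Lemma state_budget_next st t w : correct (next_state st t w) ->
  (state_budget (next_state st t w) <= state_budget st)%N.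
Proof.
move=> st'_correct; rewrite {1}/state_budget next_baseE.
apply: leq_trans (budget_swap_pass _ _ _ _) _.
  by move=> B x y; exact: st'_correct.
by rewrite leq_add2r subset_leq_card // seen_sub // => i j; exact: unseen_next.
Qed.

Lemma base_next st t w : correct (next_state st t w) ->
  (#|Vset (st_base (next_state st t w))| < #|Vset (st_base st)|)%N \/
  st_base (next_state st t w) = st_base st /\ ~~ pending (next_state st t w).
Proof.
set st' := next_state st t w => st'_correct.
have [||[same still]] := @Vset_swap_pass _ (misplaced st') _ (iota 0 K) (st_base st).
- by move=> B x y; exact: st'_correct.
- by left.
right; split=> //; rewrite negb_exists; apply/forallP => x; rewrite negbK.
rewrite [st_base st']same; case: (ltnP x.+1 K) => xK; last first.
  by rewrite next_pos_last //; apply: contraT => /st'_correct; rewrite ltnn.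
by apply/negPn/still; rewrite ?mem_iota ?next_posE ?xK //= add0n.
Qed.

End BubbleRankRound.

Record click_bandit (R : realType) (K : nat) (Pa : attr_vec K -> R)
    (Pc : exam_mat K -> R) : Prop := ClickBandit {
  attr_pmf : is_pmf Pa;
  exam_pmf : is_pmf Pc;
  identity_optimal : A1 (alpha Pa) (chi Pc);
  exam_prefix : A2 (chi Pc);
  exam_decreasing : A3 (chi Pc);
  exam_swap : A4 (alpha Pa) (chi Pc);
  exam_identity_le : A5 (chi Pc);
  alpha_decreasing : forall i j : 'I_K, (i < j)%N -> alpha Pa j < alpha Pa i;
  chi_min_gt0 : 0 < chi_min (chi Pc) }.

Section ClickModel.
Variables (R : realType) (K : nat) (Pa : attr_vec K -> R) (Pc : exam_mat K -> R).
Variable delta : R.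
Hypothesis bandit : click_bandit Pa Pc.
Implicit Types (st : bstate K) (t : nat) (L : {perm 'I_K}) (x y u v i j : 'I_K).

Notation Dmin := (Delta_min (alpha Pa)).

Lemma alpha_ge0 i : 0 <= alpha Pa i.
Proof. exact: prob_ge0 (attr_pmf bandit) (fun A => A i). Qed.

Lemma alpha_le1 i : alpha Pa i <= 1.
Proof. exact: prob_le1 (attr_pmf bandit) (fun A => A i). Qed.

Lemma alpha_diff_le1 i j : `|alpha Pa i - alpha Pa j| <= 1.
Proof.
have := alpha_ge0 i; have := alpha_le1 i; have := alpha_ge0 j; have := alpha_le1 j.
by rewrite ler_norml => *; apply/andP; split; lra.
Qed.

Lemma le_alpha i j : (i <= j)%N -> alpha Pa j <= alpha Pa i.
Proof.
by rewrite leq_eqVlt => /predU1P[/val_inj->//|/(alpha_decreasing bandit)/ltW].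
Qed.

Lemma alpha_gap_ge0 i j : (i < j)%N -> 0 <= alpha Pa i - alpha Pa j.
Proof. by rewrite subr_ge0 => /ltnW/le_alpha. Qed.

Lemma chi_ge0 L x : 0 <= chi Pc L x.
Proof. exact: prob_ge0 (exam_pmf bandit) (fun X => X (L, x)). Qed.

Lemma chi_le1 L x : chi Pc L x <= 1.
Proof. exact: prob_le1 (exam_pmf bandit) (fun X => X (L, x)). Qed.

Lemma K_gt0 : (0 < K)%N.
Proof.
case: (posnP K) => // K0; have := chi_min_gt0 bandit; rewrite /chi_min.
by case: insubP => [x _ _|_]; [have := ltn_ord x; rewrite {2}K0|rewrite ltxx].
Qed.

Lemma exam_antitone L x y : (x <= y)%N -> chi Pc L y <= chi Pc L x.
Proof.
by rewrite leq_eqVlt => /predU1P[/val_inj->//|]; exact: exam_decreasing bandit _ _ _.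
Qed.

Lemma chi_min_le L x : chi_min (chi Pc) <= chi Pc L x.
Proof.
rewrite /chi_min; case: insubP => [y _ ey|]; last by rewrite ltn_predL K_gt0.
apply: le_trans (exam_identity_le bandit L x); apply: exam_antitone.
by rewrite ey -ltnS prednK ?K_gt0.
Qed.

Lemma chi_le_max L x : chi Pc L x <= chi_max (chi Pc).
Proof.
rewrite /chi_max; case: insubP => [y _ ey|]; last by rewrite K_gt0.
have <- : chi Pc L y = chi Pc 1%g y.
  apply: (exam_prefix bandit).
  suff -> : [set z : 'I_K | (z < y)%N] = set0 by rewrite !imset0.
  by apply/setP => z; rewrite !inE ey.
by apply: exam_antitone; rewrite ey.
Qed.

Lemma chi_max_itv : 0 < chi_max (chi Pc) <= 1.
Proof.
have x := Ordinal K_gt0; apply/andP; split; last first.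
  by rewrite /chi_max; case: insubP => [y _ _|_]; rewrite ?chi_le1 ?ler01.
exact: lt_le_trans (chi_min_gt0 bandit) (le_trans (chi_min_le 1%g x) (chi_le_max _ _)).
Qed.

Lemma Delta_min_itv : 0 < Dmin <= 1.
Proof.
rewrite bigmin_le_id andbT /Delta_min; elim/big_ind: _ => // [p q p_gt0 q_gt0|p _].
  by rewrite lt_min p_gt0.
case: opairP => // x y ex ey.
by rewrite subr_gt0 (alpha_decreasing bandit) // ex ey.
Qed.

Lemma Delta_min_le i j : (i < j)%N -> Dmin <= alpha Pa i - alpha Pa j.
Proof.
move=> ij; have iK : (i.+1 < K)%N by exact: leq_ltn_trans ij (ltn_ord j).
apply: (@le_trans _ _ (alpha Pa i - alpha Pa (Ordinal iK))); last first.
  by rewrite lerD2l lerN2 le_alpha.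
apply: (@bigmin_inf_seq _ _ _ _ _ (i : nat)) => //; first by rewrite mem_iota /=.
case: opairP => [x y ex ey|]; last by rewrite leqNgt iK.
have -> : x = i by exact: val_inj.
by have -> : y = Ordinal iK by exact: val_inj.
Qed.

Definition coin_law (_ : coin_vec K) : R := (2 ^+ K)^-1.

Lemma coin_law_pmf : is_pmf coin_law.
Proof.
split=> [coins|]; first by rewrite invr_ge0 exprn_ge0.
rewrite /coin_law sumr_const card_ffun card_bool card_ord -[LHS]mulr_natr natrX.
by rewrite mulVf // expf_neq0 // pnatr_eq0.
Qed.

Definition round_law : outcome K -> R := prod_law (prod_law coin_law Pa) Pc.

Lemma round_law_pmf : is_pmf round_law.
Proof.
apply: prod_law_pmf (exam_pmf bandit); exact: prod_law_pmf coin_law_pmf (attr_pmf bandit).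
Qed.

Definition exam st t u : R :=
  expect coin_law
    (fun coins => chi Pc (display delta st t coins) (pos (display delta st t coins) u)).

Lemma prob_click st t u : prob round_law (click delta st t u) = alpha Pa u * exam st t u.
Proof.
rewrite /prob !expect_prod_law /exam -expectZ; apply: eq_expect => coins.
set c := chi _ _ _; rewrite mulrC -[alpha Pa u]/(prob Pa (fun A => A u)) -expectZ.
apply: eq_expect => A; rewrite mulrC /c -expectZ; apply: eq_expect => X.
by rewrite /click /= -natrM mulnb andbC.
Qed.

Lemma exam_ge st t u : chi_min (chi Pc) <= exam st t u.
Proof. by apply: (expect_ge coin_law_pmf) => coins; exact: chi_min_le. Qed.

(* By A2 the first of the two positions is examined equally often in both lists. *)
Lemma chi_swap_le L x y : y = x.+1 :> nat -> alpha Pa (L y) <= alpha Pa (L x) ->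
  chi Pc L y + chi Pc (swap_pos L x y) x <= chi Pc L x + chi Pc (swap_pos L x y) y.
Proof.
move=> ey le_yx; set L' := swap_pos L x y; have xy : (x < y)%N by rewrite ey.
have -> : chi Pc L' x = chi Pc L x.
  apply: (exam_prefix bandit); apply: eq_in_imset => z; rewrite inE => zx.
  by rewrite swap_posD // -val_eqE ltn_eqF // (ltn_trans zx).
have L_swap : L = swap_pos L' x y by rewrite swap_posK.
rewrite addrC lerD2l; apply/(exam_swap bandit xy L_swap).
by rewrite swap_posL swap_posR.
Qed.

Lemma chi_swap_items_le L x y i j : y = x.+1 :> nat -> alpha Pa j <= alpha Pa i ->
  (L x = i /\ L y = j) \/ (L x = j /\ L y = i) ->
  chi Pc L (pos L j) + chi Pc (swap_pos L x y) (pos (swap_pos L x y) j)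
  <= chi Pc L (pos L i) + chi Pc (swap_pos L x y) (pos (swap_pos L x y) i).
Proof.
move=> ey le_ji; wlog [Lx Ly] : L / L x = i /\ L y = j.
  move=> le_L [Lxy|[Lx Ly]]; first by apply: le_L => //; left.
  have := le_L (swap_pos L x y); rewrite swap_posL swap_posR swap_posK Lx Ly.
  by rewrite addrC [leRHS]addrC; apply=> //; left.
move=> _; set L' := swap_pos L x y; have L'i : L' y = i by rewrite swap_posR.
have L'j : L' x = j by rewrite swap_posL.
rewrite (pos_eq Lx) (pos_eq Ly) (pos_eq L'i) (pos_eq L'j).
by apply: chi_swap_le; rewrite ?Lx ?Ly.
Qed.

(* Flipping the coin of the pair is a measure-preserving involution, and it swaps the
   two items in the displayed list. *)
Lemma exam_le_unresolved st t x y i j : y = x.+1 :> nat -> odd x == odd t ->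
  unresolved delta st (st_base st x) (st_base st y) -> alpha Pa j <= alpha Pa i ->
  (st_base st x = i /\ st_base st y = j) \/ (st_base st x = j /\ st_base st y = i) ->
  exam st t j <= exam st t i.
Proof.
move=> ey odd_x unres le_ji base_xy.
pose F u coins := chi Pc (display delta st t coins) (pos (display delta st t coins) u).
have double u : exam st t u *+ 2 =
    expect coin_law (fun coins => F u coins + F u (flip x coins)).
  rewrite expectD mulr2n; congr (_ + _).
  by rewrite /exam /expect (reindex_inj (inv_inj (flipK x))).
rewrite -(ler_pMn2r (n := 2)) // !double; apply: (le_expect coin_law_pmf) => coins.
rewrite /F (display_flip coins ey odd_x unres); apply: chi_swap_items_le => //.
have xy_paired : paired t x y by rewrite /paired ey eqxx odd_x.
have /= := display_paired_items delta st coins xy_paired.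
by case: base_xy => -[-> ->]; case=> -[-> ->]; by [left|right].
Qed.

Lemma exam_le st t i j : correct delta st -> (i < j)%N ->
  paired t (pos (st_base st) i) (pos (st_base st) j) -> exam st t j <= exam st t i.
Proof.
move=> st_correct ij; have le_ji := le_alpha (ltnW ij).
case/orP => /andP[/eqP e odd_first]; last first.
  apply: (exam_le_unresolved e odd_first _ le_ji); rewrite !posK; last by right.
  by apply: contraLR ij => /st_correct; rewrite -leqNgt; exact: ltnW.
case: (boolP (unresolved delta st i j)) => unres.
  by apply: (exam_le_unresolved e odd_first _ le_ji); rewrite !posK //; left.
apply: (le_expect coin_law_pmf) => coins.
have := display_paired delta st coins e odd_first.
rewrite /= !posK (negbTE unres) => -[/pos_eq-> /pos_eq->].
by apply: exam_antitone; rewrite e.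
Qed.

Definition prob_only st t u v : R :=
  prob_diff round_law (click delta st t u) (click delta st t v).

Lemma prob_only_ge0 st t u v : 0 <= prob_only st t u v.
Proof. exact: prob_ge0 round_law_pmf _. Qed.

Lemma prob_only_drift st t i j : correct delta st -> (i < j)%N ->
  paired t (pos (st_base st) i) (pos (st_base st) j) ->
  prob_only st t j i <= (1 - Dmin) * prob_only st t i j /\
  chi_min (chi Pc) * (alpha Pa i - alpha Pa j) <= prob_only st t i j - prob_only st t j i.
Proof.
move=> st_correct ij ij_paired; have /andP[Dmin_gt0 Dmin_le1] := Delta_min_itv.
have gap := Delta_min_le ij; have gap_ge0 := alpha_gap_ge0 ij.
have exam_ge0 : 0 <= exam st t i.
  exact: le_trans (ltW (chi_min_gt0 bandit)) (exam_ge st t i).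
have alpha_j : alpha Pa j <= (1 - Dmin) * alpha Pa i.
  by have := ler_wpM2l (ltW Dmin_gt0) (alpha_le1 i); lra.
have exam_j : alpha Pa j * exam st t j <= alpha Pa j * exam st t i.
  by rewrite ler_wpM2l ?alpha_ge0 ?exam_le.
split.
  apply: (prob_diff_le round_law_pmf); first by rewrite gerBl ltW.
  rewrite !prob_click mulrA; apply: le_trans exam_j _.
  exact: ler_wpM2r.
rewrite prob_diffB !prob_click.
by have := ler_wpM2r gap_ge0 (exam_ge st t i); lra.
Qed.

Lemma expect_pair_step (F : int -> nat -> R) st t i j :
  let s := st_s st i j in let n := st_n st i j in
  let k := paired t (pos (st_base st) i) (pos (st_base st) j) in
  expect round_law (fun w => F (st_s (next_state delta st t w) i j)
                               (st_n (next_state delta st t w) i j)) =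
  F s n + k%:R * (prob_only st t i j * (F (s + 1) n.+1 - F s n)
                  + prob_only st t j i * (F (s - 1) n.+1 - F s n)).
Proof.
move=> s n k.
pose h (ci cj : bool) := F (s + ((ci%:R : int) - cj%:R) *+ k) (n + (ci != cj) * k)%N.
transitivity (expect round_law (fun w => h (click delta st t i w) (click delta st t j w))).
  by apply: eq_expect => w; have [-> ->] := next_stats delta st t w i j.
rewrite (expect_bool2 round_law_pmf) /h /= ?mul0n ?mul1n ?sub0r ?subr0 ?subrr //.
case: (k); first by rewrite mulr1n addr0 addn0 addn1 mul1r.
by rewrite mulr0n addr0 addn0 subrr !mulr0 addr0 mul0r addr0.
Qed.

End ClickModel.

Section Concentration.
Variables (R : realType) (K : nat) (Pa : attr_vec K -> R) (Pc : exam_mat K -> R).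
Variable delta : R.
Hypothesis bandit : click_bandit Pa Pc.
Implicit Types (st : bstate K) (t N : nat) (i j u v : 'I_K).

Notation Dmin := (Delta_min (alpha Pa)).
Notation logd := (ln delta^-1).
Notation law := (round_law Pa Pc).

Definition good st : bool :=
  [forall i : 'I_K, forall j : 'I_K, (i < j)%N ==>
     in_band Dmin logd (st_s st i j)%:~R (st_n st i j)%:R].

Lemma goodP st :
  reflect (forall i j, (i < j)%N -> in_band Dmin logd (st_s st i j)%:~R (st_n st i j)%:R)
          (good st).
Proof.
apply: (iffP forallP) => [st_good i j ij|st_good i].
  by have /forallP/(_ j)/implyP := st_good i; apply.
by apply/forallP => j; apply/implyP; exact: st_good.
Qed.

Lemma good_init R0 : good (init_state R0).
Proof. by apply/goodP => i j _; rewrite /in_band /= mulr0 mul0r sqrtr0 mulr0 subrr. Qed.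

Lemma good_correct st : consistent st -> good st -> correct delta st.
Proof.
case=> anti sym s_le_n /goodP st_good u v; rewrite /unresolved /ltest -ltNge => resolved.
case: (ltngtP u v) => // [vu|/val_inj eq_uv].
  have := st_good _ _ vu; rewrite /in_band anti (sym u v) rmorphN /=.
  have : 0 <= Dmin / 2 * (st_n st u v)%:R.
    by have /andP[Dmin_gt0 _] := Delta_min_itv bandit; rewrite mulr_ge0 // divr_ge0 // ltW.
  by move: resolved; set q := Num.sqrt _; lra.
have s0 : st_s st v v = 0 by have := anti v v; lia.
by move: resolved; rewrite eq_uv s0; have := sqrtr_ge0 ((st_n st v v)%:R * logd); lra.
Qed.

Lemma expect_tilted_le st t th i j :
  consistent st -> good st -> (i < j)%N -> 0 <= th <= 2^-1 ->
  expect law (fun w => tilted Dmin th (st_s (next_state delta st t w) i j)%:~R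
                                   (st_n (next_state delta st t w) i j)%:R)
  <= tilted Dmin th (st_s st i j)%:~R (st_n st i j)%:R.
Proof.
move=> st_ok st_good ij th_itv.
rewrite (expect_pair_step delta bandit (fun s n => tilted Dmin th s%:~R n%:R)) gerDl.
case: (boolP (paired _ _ _)) => [ij_paired|_]; last by rewrite mul0r.
have [drift _] := prob_only_drift bandit (good_correct st_ok st_good) ij ij_paired.
have /andP[Dmin_gt0 _] := Delta_min_itv bandit.
rewrite mul1r rmorphD rmorphB /= -natr1; apply: tilted_drift_le0 => //.
- exact: ltW.
- exact: prob_only_ge0.
- exact: prob_only_ge0.
Qed.

(* A sum of exponential supermartingales, one for each pair and each number of
   comparisons; it is at least 1 as soon as some score leaves its confidence band. *)
Definition failure N st : R :=
  Num.sqrt delta * \sum_(ij : 'I_K * 'I_K | (ij.1 < ij.2)%N) \sum_(m < N)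
    tilted Dmin (tilt logd m.+1%:R) (st_s st ij.1 ij.2)%:~R (st_n st ij.1 ij.2)%:R.

Lemma failure_ge0 N st : 0 <= failure N st.
Proof.
rewrite mulr_ge0 ?sqrtr_ge0 // sumr_ge0 // => ij _; rewrite sumr_ge0 // => m _.
exact: tilted_ge0.
Qed.

Lemma expect_failure_le N st t : consistent st -> good st ->
  expect law (fun w => failure N (next_state delta st t w)) <= failure N st.
Proof.
move=> st_ok st_good; rewrite expectZ ler_wpM2l ?sqrtr_ge0 // expect_sum.
apply: ler_sum => ij lt_ij; rewrite expect_sum; apply: ler_sum => m _.
by apply: expect_tilted_le => //; exact: tilt_itv.
Qed.

Lemma failure_ge_tilted N st i j m : (i < j)%N -> (m < N)%N ->
  Num.sqrt delta * tilted Dmin (tilt logd m.+1%:R) (st_s st i j)%:~R (st_n st i j)%:R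
  <= failure N st.
Proof.
move=> ij mN; rewrite ler_wpM2l ?sqrtr_ge0 //.
rewrite (bigD1 (i, j)) //= (bigD1 (Ordinal mN)) //= -addrA lerDl.
rewrite addr_ge0 ?sumr_ge0 // => [? _|ij' _]; first exact: tilted_ge0.
by rewrite sumr_ge0 // => ? _; exact: tilted_ge0.
Qed.

Lemma failure_init N R0 : failure N (init_state R0) <= Num.sqrt delta * (K%:R ^+ 2 * N%:R).
Proof.
rewrite ler_wpM2l ?sqrtr_ge0 // (eq_bigr (fun=> N%:R)) => [|ij _]; last first.
  rewrite (eq_bigr (fun=> 1)) ?sumr_const ?card_ord // => m _.
  by rewrite /tilted /= !mulr0 addr0 expR0.
rewrite sumr_const -[leLHS]mulr_natl ler_wpM2r ?ler0n // -natrX ler_nat.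
by apply: leq_trans (max_card _) _; rewrite card_prod !card_ord.
Qed.

Hypothesis delta01 : 0 < delta < 1.

Lemma logd_gt0 : 0 < logd.
Proof. by case/andP: delta01 => d0 d1; rewrite ln_gt0 // invf_gt1. Qed.

Lemma sqrt_deltaE : Num.sqrt delta = expR (- (logd / 2)).
Proof.
case/andP: delta01 => d0 _; have delta_exp : expR (- (logd / 2)) ^+ 2 = delta.
  by rewrite expr2 -expRD -opprD -splitr lnV ?posrE // opprK lnK ?posrE.
by rewrite -{1}delta_exp sqrtr_sqr ger0_norm ?expR_ge0.
Qed.

Lemma bad_failure_ge1 N st : consistent st -> ~~ good st ->
  (forall u v, st_n st u v <= N)%N -> 1 <= failure N st.
Proof.
move=> st_ok /forallPn[i /forallPn[j]]; rewrite negb_imply => /andP[ij out] n_le.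
have /andP[Dmin_gt0 Dmin_le1] := Delta_min_itv bandit.
have Dmin01 : 0 <= Dmin <= 1 by rewrite ltW.
have s_ge : - (st_n st i j)%:R <= (st_s st i j)%:~R :> R.
  have := consistent_ge i j st_ok.
  by rewrite -(ler_int R) rmorphN.
have n_gt0 : (0 < st_n st i j)%N.
  rewrite -(ltr_nat R); apply: lt_le_trans logd_gt0 _.
  exact: out_band_count_ge Dmin01 logd_gt0 _ s_ge out.
have mN : ((st_n st i j).-1 < N)%N by rewrite prednK.
apply: le_trans (failure_ge_tilted st ij mN); rewrite prednK // sqrt_deltaE.
rewrite -[leLHS]expR0 -(addNr (logd / 2)) expRD ler_wpM2l ?expR_ge0 //.
exact: tilted_out_band Dmin01 logd_gt0 _ s_ge out.
Qed.

End Concentration.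

Section RoundRegret.
Variables (R : realType) (K : nat) (Pa : attr_vec K -> R) (Pc : exam_mat K -> R).
Variable delta : R.
Hypothesis bandit : click_bandit Pa Pc.
Implicit Types (st : bstate K) (t : nat) (L : {perm 'I_K}) (x y z k : 'I_K).
Implicit Types (coins : coin_vec K).

Definition round_regret L : R := opt_rew (alpha Pa) (chi Pc) - rew (alpha Pa) (chi Pc) L.

Lemma opt_rew_le : opt_rew (alpha Pa) (chi Pc) <= rew (alpha Pa) (chi Pc) 1%g.
Proof.
apply: bigmax_le => [|L _]; last exact: identity_optimal bandit L.
by apply: sumr_ge0 => x _; rewrite mulr_ge0 ?(chi_ge0 bandit) ?(alpha_ge0 bandit).
Qed.

Lemma round_regret_le_gap L b : 0 <= b -> (forall k, alpha Pa k - alpha Pa (L k) <= b) ->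
  round_regret L <= K%:R * chi_max (chi Pc) * b.
Proof.
move=> b_ge0 gap_le.
apply: (@le_trans _ _ (rew (alpha Pa) (chi Pc) 1%g - rew (alpha Pa) (chi Pc) L)).
  by rewrite lerD2r opt_rew_le.
have -> : K%:R * chi_max (chi Pc) * b = \sum_(k : 'I_K) chi_max (chi Pc) * b.
  by rewrite sumr_const card_ord -mulrA mulr_natl.
rewrite -sumrB ler_sum // => k _.
rewrite perm1; have chi1_ge0 := chi_ge0 bandit 1%g k.
have := ler_wpM2r (alpha_ge0 bandit (L k)) (exam_identity_le bandit L k).
have := ler_wpM2l chi1_ge0 (gap_le k).
have := ler_wpM2r b_ge0 (chi_le_max bandit 1%g k); lra.
Qed.

Definition rise L x : R := Num.max 0 (alpha Pa (L (next_pos x)) - alpha Pa (L x)).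

Definition ascent L : R := \sum_(x : 'I_K | (x.+1 < K)%N) rise L x.

Lemma rise_ge0 L x : 0 <= rise L x.
Proof. by rewrite le_max lexx. Qed.

Lemma ascent_ge0 L : 0 <= ascent L.
Proof. by apply: sumr_ge0 => x _; exact: rise_ge0. Qed.

Lemma climb_le_ascent L k y : (k <= y)%N -> alpha Pa (L y) - alpha Pa (L k) <= ascent L.
Proof.
move=> ky; pose f p := alpha Pa (L (insubd k p)).
have fE z : f z = alpha Pa (L z) by rewrite /f valKd.
apply: (@le_trans _ _ (f y - f k)); first by rewrite !fE.
rewrite -(telescope_sumr f ky) (big_nat_widen _ _ K); last exact: ltnW.
rewrite (big_nat_widenl _ 0%N) // big_mkord.
apply: (ler_sum_inj (f := id)) => // [z|z|z _]; last exact: rise_ge0.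
  by case/andP=> /andP[_ zy] _; exact: leq_ltn_trans zy (ltn_ord y).
case/andP=> /andP[_ zy] _; rewrite fE /rise le_max (_ : f z.+1 = alpha Pa (L (next_pos z))).
  by rewrite lexx orbT.
rewrite -(fE (next_pos z)) next_posE ifT //.
exact: leq_ltn_trans zy (ltn_ord y).
Qed.

Lemma late_item L k : exists2 y : 'I_K, (k <= y)%N & (L y <= k)%N.
Proof.
case: (boolP [exists y : 'I_K, (k <= y)%N && (L y <= k)%N]).
  by case/existsP=> y /andP[]; exists y.
rewrite negb_exists => /forallP late.
have sub : pos L @: [set i : 'I_K | (i <= k)%N] \subset [set x : 'I_K | (x < k)%N].
  apply/subsetP => x /imsetP[i]; rewrite !inE => ik ->.
  by have := late (pos L i); rewrite posK ik andbT -ltnNge.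
have := subset_leq_card sub; rewrite card_imset; last exact: perm_inj.
have -> : [set i : 'I_K | (i <= k)%N] = k |: [set x : 'I_K | (x < k)%N].
  by apply/setP => i; rewrite !inE leq_eqVlt -val_eqE.
by rewrite cardsU1 inE ltnn /= add1n ltnn.
Qed.

Lemma gap_le_ascent L k : alpha Pa k - alpha Pa (L k) <= ascent L.
Proof.
have [y ky yk] := late_item L k.
by have := climb_le_ascent L ky; have := le_alpha bandit yk; lra.
Qed.

Lemma round_regret_le_ascent L :
  round_regret L <= K%:R * chi_max (chi Pc) * Num.min 1 (ascent L).
Proof.
apply: round_regret_le_gap => [|k]; first by rewrite le_min ler01 ascent_ge0.
rewrite le_min gap_le_ascent andbT.
exact: le_trans (ler_norm _) (alpha_diff_le1 bandit _ _).
Qed.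

Lemma round_regret_le_size L : round_regret L <= K%:R * (1 < K)%N%:R.
Proof.
have /andP[chi_gt0 chi_le1] := chi_max_itv bandit.
apply: (@le_trans _ _ (K%:R * chi_max (chi Pc) * (1 < K)%N%:R)); last first.
  by rewrite ler_wpM2r // ler_piMr.
apply: round_regret_le_gap => // k; case: ltnP => K1.
  exact: le_trans (ler_norm _) (alpha_diff_le1 bandit _ _).
suff -> : L k = k by rewrite subrr.
by apply: val_inj => /=; have := ltn_ord k; have := ltn_ord (L k); lia.
Qed.

Definition unresolved_gap st x : R :=
  (unresolved delta st (st_base st x) (st_base st (next_pos x)))%:R
  * `|alpha Pa (st_base st x) - alpha Pa (st_base st (next_pos x))|.

Definition paired_gap t st : R := \sum_(x : 'I_K | pair_first t x) unresolved_gap st x.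

Lemma unresolved_gap_ge0 st x : 0 <= unresolved_gap st x.
Proof. by rewrite mulr_ge0. Qed.

Lemma paired_gap_ge0 t st : 0 <= paired_gap t st.
Proof. by apply: sumr_ge0 => x _; exact: unresolved_gap_ge0. Qed.

Lemma paired_gap_le t st : paired_gap t st <= K.-1%:R.
Proof.
apply: (@le_trans _ _ (\sum_(x : 'I_K | pair_first t x) 1)).
  apply: ler_sum => x _; rewrite mulr_ile1 ?lern1 ?leq_b1 //.
  exact: alpha_diff_le1 bandit _ _.
rewrite sumr_const ler_nat -card_inner_pos subset_leq_card //.
by apply/subsetP => x /andP[_ xK]; rewrite inE.
Qed.

Definition displacement st t coins x : R :=
  `|alpha Pa (display delta st t coins x) - alpha Pa (st_base st x)|.

Lemma displacement_paired_le st t coins x : pair_first t x ->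
  displacement st t coins x <= unresolved_gap st x /\
  displacement st t coins (next_pos x) <= unresolved_gap st x.
Proof.
case/pair_firstP=> ex odd_x; rewrite /displacement /unresolved_gap.
have [-> ->] := display_paired delta st coins ex odd_x.
case: ifP => [/andP[-> _]|_]; first by rewrite mul1r distrC lexx.
by rewrite !subrr normr0 mulr_ge0.
Qed.

Lemma sum_displacement_le st t coins :
  \sum_x displacement st t coins x <= 2 * paired_gap t st.
Proof.
rewrite (sum_round t) [X in _ + X]big1 => [|x /andP[not_first not_second]]; last first.
  by rewrite /displacement display_unpaired // subrr normr0.
rewrite addr0 mulr_sumr ler_sum // => x first_x.
by have [] := displacement_paired_le st coins first_x; lra.
Qed.

Lemma base_rise_le st x : correct delta st ->
  alpha Pa (st_base st (next_pos x)) - alpha Pa (st_base st x) <= unresolved_gap st x.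
Proof.
move=> st_correct; rewrite /unresolved_gap.
case: (boolP (unresolved _ _ _ _)) => [_|/st_correct/ltnW/(le_alpha bandit)].
  by rewrite mul1r distrC ler_norm.
by rewrite mul0r subr_le0.
Qed.

Lemma display_rise_paired_le st t coins x : correct delta st -> pair_first t x ->
  rise (display delta st t coins) x <= unresolved_gap st x.
Proof.
move=> st_correct /pair_firstP[ex odd_x]; rewrite ge_max unresolved_gap_ge0 /=.
have [-> ->] := display_paired delta st coins ex odd_x.
case: ifP => [/andP[unres _]|_]; last exact: base_rise_le.
by rewrite /unresolved_gap unres mul1r ler_norm.
Qed.

Lemma display_rise_le st t coins x : correct delta st ->
  rise (display delta st t coins) x
  <= unresolved_gap st x
     + (displacement st t coins x + displacement st t coins (next_pos x)).
Proof.
move=> st_correct; rewrite /displacement ge_max !addr_ge0 ?unresolved_gap_ge0 //=.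
have := base_rise_le x st_correct.
set Lx := alpha _ (display _ _ _ _ x); set Ln := alpha _ (display _ _ _ _ _).
have := ler_norm (Ln - alpha Pa (st_base st (next_pos x))).
by have := ler_norm (alpha Pa (st_base st x) - Lx); rewrite [`|_ - Lx|]distrC; lra.
Qed.

(* Pairs not compared in round [t] inherit the displacement of the two compared pairs
   around them. *)
Lemma ascent_display_le st t coins : correct delta st ->
  ascent (display delta st t coins) <= 3 * paired_gap t st + paired_gap t.+1 st.
Proof.
move=> st_correct; set L := display _ _ _ _; pose d := displacement st t coins.
have split_parity : ascent L =
    \sum_(x : 'I_K | pair_first t x) rise L x
    + \sum_(x : 'I_K | pair_first t.+1 x) rise L x.
  rewrite /ascent (bigID (fun x : 'I_K => odd x == odd t)) /=.
  by congr (_ + _); apply: eq_bigl => x; rewrite /pair_first /=; lia.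
have same_parity : \sum_(x : 'I_K | pair_first t x) rise L x <= paired_gap t st.
  by apply: ler_sum => x; exact: display_rise_paired_le.
have other_parity : \sum_(x : 'I_K | pair_first t.+1 x) rise L x
    <= paired_gap t.+1 st + \sum_(x : 'I_K | pair_first t.+1 x) (d x + d (next_pos x)).
  by rewrite -big_split; apply: ler_sum => x _; exact: display_rise_le.
have displaced :
    \sum_(x : 'I_K | pair_first t.+1 x) (d x + d (next_pos x)) <= \sum_x d x.
  by rewrite (sum_round t.+1 d) lerDl sumr_ge0 // => x _; exact: normr_ge0.
have := sum_displacement_le st t coins; rewrite -/d split_parity; lra.
Qed.

End RoundRegret.

Section Potential.
Variables (R : realType) (K : nat) (Pa : attr_vec K -> R) (Pc : exam_mat K -> R).
Variable delta : R.
Hypothesis bandit : click_bandit Pa Pc.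
Implicit Types (st : bstate K) (t : nat) (w : outcome K).
Implicit Types (i j x : 'I_K) (ij : 'I_K * 'I_K).

Notation Dmin := (Delta_min (alpha Pa)).
Notation logd := (ln delta^-1).
Notation law := (round_law Pa Pc).
Notation good := (good Pa delta).
Notation next := (next_state delta).
Notation paired_gap := (paired_gap Pa delta).

Definition score_cap : nat := (Num.truncn (16 * logd / Dmin)).+1.

Definition score_max : R := score_cap%:R + Dmin^-1.

Lemma score_max_ge0 : 0 <= score_max.
Proof.
by have /andP[/ltW Dmin_ge0 _] := Delta_min_itv bandit; rewrite addr_ge0 ?invr_ge0.
Qed.

Lemma damped_le_max s : damped score_cap (1 - Dmin) s <= score_max.
Proof.
have /andP[Dmin_gt0 Dmin_le1] := Delta_min_itv bandit.
rewrite /score_max -{2}(subKr 1 Dmin); apply: damped_le.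
by rewrite subr_ge0 Dmin_le1 gtrBl.
Qed.

Definition gain t st (ij : 'I_K * 'I_K) : R :=
  (paired t (pos (st_base st) ij.1) (pos (st_base st) ij.2)
     && unresolved delta st ij.1 ij.2)%:R
  * (chi_min (chi Pc) * (alpha Pa ij.1 - alpha Pa ij.2)).

Lemma gain_ge0 t st ij : (ij.1 < ij.2)%N -> 0 <= gain t st ij.
Proof.
move=> ij_lt; apply: mulr_ge0 => //.
by rewrite mulr_ge0 ?(alpha_gap_ge0 bandit) // ltW // (chi_min_gt0 bandit).
Qed.

Definition active_gap t st : R := if pending delta st then 0 else paired_gap t st.

Lemma active_gap_ge0 t st : 0 <= active_gap t st.
Proof. by rewrite /active_gap; case: ifP => // _; exact: paired_gap_ge0. Qed.

Lemma active_gap_le t st : active_gap t st <= K.-1%:R.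
Proof. by rewrite /active_gap; case: ifP => // _; exact: paired_gap_le _ bandit _ _. Qed.

Lemma gain_neighbours_ge st t x : ~~ pending delta st -> pair_first t x ->
  chi_min (chi Pc) * unresolved_gap Pa delta st x
  <= gain t st (neighbours (st_base st) x).
Proof.
rewrite negb_exists => /forallP/(_ x); rewrite negbK => unres_rev first_x.
have [ex odd_x] := pair_firstP first_x; have /andP[_ xK] := first_x.
have x_paired : paired t x (next_pos x) by rewrite /paired ex eqxx odd_x.
have chi_ge0 := ltW (chi_min_gt0 bandit).
have [nb_lt nbE] := neighboursE (st_base st) xK; rewrite /gain /unresolved_gap.
case: nbE nb_lt => -> /=; rewrite !permK_pos => nb_lt.
  by rewrite x_paired ger0_norm ?(alpha_gap_ge0 bandit) // mulrCA.
rewrite pairedC x_paired unres_rev mul1r ler_wpM2l // distrC.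
have gap_ge0 := alpha_gap_ge0 bandit nb_lt.
by rewrite ger0_norm // ler_piMl ?lern1 ?leq_b1.
Qed.

Lemma sum_gain_ge st t : chi_min (chi Pc) * active_gap t st
  <= \sum_(ij : 'I_K * 'I_K | (ij.1 < ij.2)%N) gain t st ij.
Proof.
rewrite /active_gap; case: ifPn => [_|not_pending].
  by rewrite mulr0 sumr_ge0 // => ij; exact: gain_ge0.
rewrite mulr_sumr; apply: (ler_sum_inj (f := neighbours (st_base st))).
- by move=> x y /andP[_ xK] /andP[_ yK]; exact: neighbours_inj.
- by move=> x /andP[_ xK]; have [] := neighboursE (st_base st) xK.
- by move=> x; exact: gain_neighbours_ge.
- by move=> ij; exact: gain_ge0.
Qed.

Definition total_score st : R :=
  \sum_(ij : 'I_K * 'I_K | (ij.1 < ij.2)%N)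
     damped score_cap (1 - Dmin) (st_s st ij.1 ij.2).

Lemma total_score_init R0 : total_score (init_state R0) = 0.
Proof. by rewrite /total_score big1 // => ij _; exact: damped0. Qed.

Lemma total_score_le st (S : {set 'I_K * 'I_K}) : consistent st ->
  (forall i j, (i < j)%N -> (i, j) \notin S -> st_n st i j = 0%N) ->
  total_score st <= score_max * #|S|%:R.
Proof.
move=> st_ok n0; rewrite mulr_natr -sumr_const [leRHS]big_mkcond [leLHS]big_mkcond /=.
apply: ler_sum => -[i j] _ /=; case: ifP => [ij|_]; last first.
  by case: ifP => // _; exact: score_max_ge0.
case: ifPn => [_|notin]; first exact: damped_le_max.
by rewrite (consistent_score0 st_ok (n0 i j ij notin)) damped0.
Qed.

Lemma total_score_le_budget st : consistent st ->
  total_score st <= score_max * (state_budget st)%:R.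
Proof.
move=> st_ok; apply: le_trans (total_score_le (S := seen (st_n st) (st_base st)) st_ok _) _.
  by move=> i j ij /(notin_seen ij)[].
by rewrite ler_wpM2l ?score_max_ge0 // ler_nat leq_addr.
Qed.

Lemma total_score_next_le_budget st t w : consistent st ->
  total_score (next st t w) <= score_max * (state_budget st)%:R.
Proof.
move=> st_ok; have st'_ok := consistent_next delta t w st_ok.
apply: le_trans (total_score_le (S := seen (st_n st) (st_base st)) st'_ok _) _.
  by move=> i j; exact: unseen_next.
by rewrite ler_wpM2l ?score_max_ge0 // ler_nat leq_addr.
Qed.

Definition reserve st : R := 2 * #|Vset (st_base st)|%:R + (pending delta st)%:R.

Lemma reserve_ge0 st : 0 <= reserve st.
Proof. by rewrite addr_ge0 ?mulr_ge0. Qed.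

(* The part of the regret of round [t] that the drift of the scores does not cover: the
   pairs compared only in round [t.+1], or the whole round if the state is pending. *)
Definition deferred t st : R :=
  if pending delta st then 1 else Num.min 1 (paired_gap t.+1 st).

Lemma deferred_le1 t st : deferred t st <= 1.
Proof. by rewrite /deferred; case: ifP => // _; rewrite ge_min lexx. Qed.

Lemma deferred_le_reserve t st : deferred t st <= reserve st + K.-1%:R.
Proof.
have : 0 <= 2 * #|Vset (st_base st)|%:R :> R by rewrite mulr_ge0.
have : 0 <= K.-1%:R :> R by []; have := paired_gap_le delta bandit t.+1 st.
have : Num.min 1 (paired_gap t.+1 st) <= paired_gap t.+1 st by rewrite ge_min lexx orbT.
by rewrite /deferred /reserve; case: ifP => _ /=; lra.
Qed.

Lemma paired_gap_next st t w : st_base (next st t w) = st_base st ->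
  paired_gap t.+1 (next st t w) = paired_gap t.+1 st.
Proof.
move=> same; apply: eq_bigr => x /pair_firstP[ex odd_x].
rewrite /unresolved_gap same /unresolved.
have [-> ->] := next_stats delta st t w (st_base st x) (st_base st (next_pos x)).
rewrite !permK_pos (_ : paired _ _ _ = false) ?mulr0n ?muln0 ?addr0 ?addn0 //.
by apply/negbTE; rewrite /paired ex; move: odd_x => /=; lia.
Qed.

Lemma reserve_next st t w : correct delta (next st t w) ->
  reserve (next st t w) - active_gap t.+1 (next st t w) + deferred t st <= reserve st.
Proof.
move=> st'_correct; rewrite /reserve /deferred /active_gap.
have p_ge0 : 0 <= (pending delta st)%:R :> R by [].
case: (base_next st'_correct) => [lt_Vset|[same not_pending]].
  have p'_le1 : (pending delta (next st t w))%:R <= 1 :> R by rewrite lern1 leq_b1.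
  have := active_gap_ge0 t.+1 (next st t w); have := deferred_le1 t st.
  move: lt_Vset; rewrite -(ler_nat R) -natr1 /active_gap /deferred; lra.
rewrite same (negbTE not_pending) (paired_gap_next same) /=.
have := paired_gap_ge0 Pa delta t.+1 st.
have : Num.min 1 (paired_gap t.+1 st) <= paired_gap t.+1 st by rewrite ge_min lexx orbT.
by case: ifP => _ /=; lra.
Qed.

(* The factor 4 pays for the weight 3 of the compared pairs in the regret of a round,
   and for [active_gap], which passes the other pairs on to the next round. *)
Definition score_weight : R := 4 / chi_min (chi Pc).

Lemma score_weight_ge0 : 0 <= score_weight.
Proof. by rewrite divr_ge0 // ltW // (chi_min_gt0 bandit). Qed.

Definition potential t st : R :=
  score_weight * (score_max * (state_budget st)%:R - total_score st)
  + (reserve st + K.-1%:R - active_gap t st).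

Lemma potential_ge0 t st : consistent st -> 0 <= potential t st.
Proof.
move=> st_ok; apply: addr_ge0.
  by rewrite mulr_ge0 ?score_weight_ge0 // subr_ge0 total_score_le_budget.
by have := active_gap_le t st; have := reserve_ge0 st; lra.
Qed.

Lemma potential_next_le st t w : consistent st -> good st ->
  (good (next st t w))%:R * potential t.+1 (next st t w)
  <= score_weight * (score_max * (state_budget st)%:R - total_score (next st t w))
     + (reserve st + K.-1%:R - deferred t st).
Proof.
move=> st_ok st_good; set st' := next st t w.
case: (boolP (good st')) => [st'_good|_]; last first.
  rewrite mul0r; apply: addr_ge0; last by rewrite subr_ge0 deferred_le_reserve.
  by rewrite mulr_ge0 ?score_weight_ge0 // subr_ge0 total_score_next_le_budget.
have st'_correct := good_correct bandit (consistent_next delta t w st_ok) st'_good.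
rewrite mul1r; apply: lerD; last by have := reserve_next st'_correct; rewrite -/st'; lra.
rewrite ler_wpM2l ?score_weight_ge0 // lerD2r ler_wpM2l ?score_max_ge0 // ler_nat.
exact: state_budget_next.
Qed.

Lemma round_regret_le_drift st t coins : consistent st -> good st ->
  round_regret Pa Pc (display delta st t coins)
  <= K%:R * chi_max (chi Pc) * (3 * active_gap t st + deferred t st).
Proof.
move=> st_ok st_good; have /andP[chi_gt0 _] := chi_max_itv bandit.
apply: le_trans (round_regret_le_ascent bandit _) _.
rewrite ler_wpM2l ?mulr_ge0 ?(ltW chi_gt0) //.
have := ascent_display_le bandit t coins (good_correct bandit st_ok st_good).
rewrite /active_gap /deferred; case: ifP => _ asc_le.
  by rewrite mulr0 add0r ge_min lexx.
by rewrite addr_minr le_min !ge_min asc_le orbT lerDr mulr_ge0 ?paired_gap_ge0.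
Qed.

Hypothesis delta01 : 0 < delta < 1.

Lemma score_cap_itv : 16 * logd / Dmin <= score_cap%:R <= 16 * logd / Dmin + 1.
Proof.
have /andP[Dmin_gt0 _] := Delta_min_itv bandit.
have cap_ge0 : 0 <= 16 * logd / Dmin by rewrite divr_ge0 ?mulr_ge0 ?ltW ?logd_gt0.
have /andP[cap_ge cap_lt] := truncn_itv cap_ge0.
by rewrite /score_cap ltW //= -[leLHS]natr1 lerD2r.
Qed.

Lemma unresolved_le_cap st i j : good st -> (i < j)%N -> unresolved delta st i j ->
  st_s st i j <= score_cap%:Z.
Proof.
move=> /goodP st_good ij unres; have /andP[Dmin_gt0 _] := Delta_min_itv bandit.
rewrite -(ler_int R); have /andP[cap_ge _] := score_cap_itv; apply: le_trans cap_ge.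
exact: in_band_sqrt_le Dmin_gt0 (ltW (logd_gt0 delta01)) (ler0n _ _) (st_good i j ij) unres.
Qed.

Lemma expect_damped_ge st t i j : consistent st -> good st -> (i < j)%N ->
  damped score_cap (1 - Dmin) (st_s st i j) + gain t st (i, j)
  <= expect law (fun w => damped score_cap (1 - Dmin) (st_s (next st t w) i j)).
Proof.
move=> st_ok st_good ij.
rewrite (expect_pair_step delta bandit (fun s _ => damped score_cap (1 - Dmin) s)) lerD2l.
rewrite /gain /=; case: (boolP (paired _ _ _)) => [ij_paired|_]; last by rewrite !mul0r.
have st_correct := good_correct bandit st_ok st_good.
have [ratio drift] := prob_only_drift bandit st_correct ij ij_paired.
rewrite mul1r /=; case: (boolP (unresolved _ _ _ _)) => [unres|_].
  by rewrite mul1r damped_drift_linear // unresolved_le_cap.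
have /andP[Dmin_gt0 Dmin_le1] := Delta_min_itv bandit.
rewrite mul0r; apply: damped_drift_ge0 ratio; last exact: prob_only_ge0.
by rewrite subr_ge0 Dmin_le1 gerBl ltW.
Qed.

Lemma expect_total_score_ge st t : consistent st -> good st ->
  total_score st + chi_min (chi Pc) * active_gap t st
  <= expect law (fun w => total_score (next st t w)).
Proof.
move=> st_ok st_good; apply: le_trans (lerD (lexx _) (sum_gain_ge st t)) _.
by rewrite expect_sum -big_split; apply: ler_sum => -[i j] /= ij; exact: expect_damped_ge.
Qed.

Lemma expect_potential_le st t : consistent st -> good st ->
  expect law (fun w => (good (next st t w))%:R * potential t.+1 (next st t w))
  <= potential t st - (3 * active_gap t st + deferred t st).
Proof.
move=> st_ok st_good; have law_pmf := round_law_pmf bandit.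
have step_le w := potential_next_le t w st_ok st_good.
apply: le_trans (le_expect law_pmf step_le) _.
rewrite expectD expectZ expectB !(expect_cst law_pmf) /potential.
have drift := ler_wpM2l score_weight_ge0 (expect_total_score_ge t st_ok st_good).
have weight_chi : score_weight * (chi_min (chi Pc) * active_gap t st) = 4 * active_gap t st.
  by rewrite mulrA divfK // gt_eqF // (chi_min_gt0 bandit).
by rewrite mulrDr weight_chi in drift; lra.
Qed.

End Potential.

Section RegretBound.
Variables (R : realType) (K : nat) (Pa : attr_vec K -> R) (Pc : exam_mat K -> R).
Variable delta : R.
Hypothesis bandit : click_bandit Pa Pc.
Hypothesis delta01 : 0 < delta < 1.
Implicit Types (st : bstate K) (t m N : nat).

Notation Dmin := (Delta_min (alpha Pa)).
Notation logd := (ln delta^-1).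
Notation law := (round_law Pa Pc).
Notation next := (next_state delta).

Lemma regret_fromS m t st : regret_from Pa Pc delta m.+1 t st =
  expect law (fun w => round_regret Pa Pc (display delta st t w.1.1)
                       + regret_from Pa Pc delta m t.+1 (next st t w)).
Proof. by rewrite !expect_prod_law. Qed.

Lemma regret_from_le_cst b m t st : (forall L, round_regret Pa Pc L <= b) ->
  regret_from Pa Pc delta m t st <= m%:R * b.
Proof.
move=> le_b; elim: m t st => [|m IH] t st; first by rewrite mul0r.
rewrite regret_fromS; apply: (expect_le (round_law_pmf bandit)) => w.
by rewrite -natr1 mulrDl mul1r addrC lerD.
Qed.

Lemma regret_from_le_bad m t st N : consistent st -> ~~ good Pa delta st ->
  (forall u v, st_n st u v <= N)%N ->
  regret_from Pa Pc delta m t st <= K%:R * m%:R * failure Pa delta N st.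
Proof.
move=> st_ok bad n_le; have regret_le L : round_regret Pa Pc L <= K%:R.
  by apply: le_trans (round_regret_le_size bandit L) _; rewrite ler_piMr ?lern1 ?leq_b1.
apply: le_trans (regret_from_le_cst m t st regret_le) _.
by rewrite [K%:R * _]mulrC ler_peMr ?mulr_ge0 // (bad_failure_ge1 bandit).
Qed.

Lemma regret_from_le m t st N : consistent st -> (forall u v, st_n st u v + m <= N)%N ->
  regret_from Pa Pc delta m t st
  <= K%:R * chi_max (chi Pc) * ((good Pa delta st)%:R * potential Pa Pc delta t st)
     + K%:R * m%:R * failure Pa delta N st.
Proof.
have /andP[chi_gt0 _] := chi_max_itv bandit.
have Kchi_ge0 : 0 <= K%:R * chi_max (chi Pc) by rewrite mulr_ge0 // ltW.
elim: m t st => [|m IH] t st st_ok n_le.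
  by rewrite mulr0 mul0r addr0 mulr_ge0 // mulr_ge0 // potential_ge0.
case: (boolP (good Pa delta st)) => [st_good|bad]; last first.
  rewrite mul0r mulr0 add0r regret_from_le_bad // => u v.
  by apply: leq_trans (n_le u v); exact: leq_addr.
have round_le w : round_regret Pa Pc (display delta st t w.1.1)
    + regret_from Pa Pc delta m t.+1 (next st t w)
  <= K%:R * chi_max (chi Pc)
       * (3 * active_gap Pa delta t st + deferred Pa delta t st
          + (good Pa delta (next st t w))%:R * potential Pa Pc delta t.+1 (next st t w))
     + K%:R * m%:R * failure Pa delta N (next st t w).
  rewrite mulrDr -[leRHS]addrA; apply: lerD; first exact: round_regret_le_drift.
  apply: IH => [|u v]; first exact: consistent_next.
  by apply: leq_trans (n_le u v); rewrite -addSnnS leq_add2r next_count_le.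
rewrite regret_fromS mul1r; apply: le_trans (le_expect (round_law_pmf bandit) round_le) _.
rewrite expectD (expectZ _ (K%:R * chi_max _)) (expectZ _ (K%:R * m%:R)).
rewrite expectD (expect_cst (round_law_pmf bandit)).
apply: lerD.
  by rewrite ler_wpM2l // -lerBrDl expect_potential_le.
apply: le_trans (ler_wpM2l _ (expect_failure_le bandit N t st_ok st_good)) _.
  by rewrite mulr_ge0.
by rewrite ler_wpM2r ?failure_ge0 // ler_wpM2l // ler_nat.
Qed.

Lemma regret_le_potential R0 n : bubblerank_regret Pa Pc delta R0 n
  <= K%:R * chi_max (chi Pc) * potential Pa Pc delta 1 (init_state R0)
     + Num.sqrt delta * K%:R ^+ 3 * n%:R ^+ 2.
Proof.
have := @regret_from_le n 1 _ n (consistent_init R0) (fun u v => leqnn n).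
rewrite good_init mul1r => /le_trans; apply; rewrite lerD2l.
apply: le_trans (ler_wpM2l _ (failure_init Pa delta n R0)) _; first by rewrite mulr_ge0.
by rewrite le_eqVlt; apply/predU1P; left; ring.
Qed.

Lemma score_max_le : 1 <= logd -> score_max Pa delta <= 18 * (logd / Dmin).
Proof.
move=> logd_ge1; have /andP[Dmin_gt0 Dmin_le1] := Delta_min_itv bandit.
have /andP[_ cap_le] := score_cap_itv bandit delta01.
have : 1 <= Dmin^-1 by rewrite invf_ge1.
have : Dmin^-1 <= logd / Dmin by rewrite ler_peMl // invr_ge0 ltW.
by rewrite /score_max; move: cap_le; rewrite -mulrA; lra.
Qed.

Lemma potential_init_le R0 : 1 <= logd ->
  potential Pa Pc delta 1 (init_state R0)
  <= 180 * ((K%:R - 1 + 2 * #|Vset R0|%:R) / Dmin) * logd / chi_min (chi Pc).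
Proof.
move=> logd_ge1; have /andP[Dmin_gt0 Dmin_le1] := Delta_min_itv bandit.
have chi_gt0 := chi_min_gt0 bandit; have K_pos := K_gt0 bandit.
have chi_le1 : chi_min (chi Pc) <= 1.
  exact: le_trans (chi_min_le bandit 1%g (Ordinal K_pos)) (chi_le1 bandit _ _).
have -> : K%:R - 1 + 2 * #|Vset R0|%:R = (K.-1 + 2 * #|Vset R0|)%:R :> R.
  by rewrite natrD natrM -subn1 natrB.
set C : R := _%:R; have C_ge0 : 0 <= C by [].
have budget_le : (state_budget (init_state R0))%:R <= C.
  by rewrite ler_nat leq_add2r card_seen0.
have unit_le : C <= logd / Dmin / chi_min (chi Pc) * C.
  rewrite ler_peMl // !ler_pdivlMr // mul1r; apply: le_trans logd_ge1.
  by rewrite mulr_ile1 // ltW.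
have score_le : score_max Pa delta * (state_budget (init_state R0))%:R
    <= 18 * (logd / Dmin) * C.
  by apply: ler_pM => //; [exact: score_max_ge0 _ bandit|exact: score_max_le].
rewrite /potential total_score_init subr0 /reserve pending_init /= addr0.
have := ler_wpM2l (score_weight_ge0 bandit) score_le.
rewrite {2}/score_weight; have -> : 4 / chi_min (chi Pc) * (18 * (logd / Dmin) * C)
    = 72 * (logd / Dmin / chi_min (chi Pc) * C) by ring.
have -> : 180 * (C / Dmin) * logd / chi_min (chi Pc)
    = 180 * (logd / Dmin / chi_min (chi Pc) * C) by ring.
have := active_gap_ge0 Pa delta 1 (init_state R0).
have -> : 2 * #|Vset R0|%:R + K.-1%:R = C :> R by rewrite /C natrD natrM addrC.
lra.
Qed.

Lemma regret_le_low_confidence R0 n : logd <= 1 ->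
  bubblerank_regret Pa Pc delta R0 n <= Num.sqrt delta * K%:R ^+ 3 * n%:R ^+ 2.
Proof.
move=> logd_le1.
apply: le_trans (regret_from_le_cst n 1 _ (round_regret_le_size bandit)) _.
have sqrt_ge : 2^-1 <= Num.sqrt delta.
  by rewrite sqrt_deltaE //; apply: le_trans (expR_ge1Dx _); lra.
rewrite mulrC; apply: ler_pM; rewrite ?mulr_ge0 //.
  case: (ltnP 1 K) => [K2|_]; last by rewrite mulr0 mulr_ge0 ?sqrtr_ge0 ?exprn_ge0.
  apply: le_trans (ler_wpM2r _ sqrt_ge); last by rewrite exprn_ge0.
  rewrite mulr1 ler_pdivlMl // exprS mulrC ler_wpM2l // -natrX ler_nat.
  by rewrite (leq_trans K2) // -mulnn leq_pmulr // ltnW.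
by rewrite -natrX ler_nat -mulnn; case: n => // n; rewrite leq_pmulr.
Qed.

End RegretBound.

Theorem theorem1 (R : realType) (K : nat)
  (Pa : attr_vec K -> R) (Pc : exam_mat K -> R)
  (delta : R) (n : nat) (R0 : {perm 'I_K}) :
  is_pmf Pa -> is_pmf Pc ->
  A1 (alpha Pa) (chi Pc) -> A2 (chi Pc) -> A3 (chi Pc) ->
  A4 (alpha Pa) (chi Pc) -> A5 (chi Pc) ->
  (forall i j : 'I_K, (i < j)%N -> alpha Pa j < alpha Pa i) ->
  (forall i : 'I_K, 0 < alpha Pa i) ->
  0 < chi_min (chi Pc) ->
  0 < delta < 1 ->
  bubblerank_regret Pa Pc delta R0 n <=
    180 * K%:R * (chi_max (chi Pc) / chi_min (chi Pc))
      * ((K%:R - 1 + 2 * #|Vset R0|%:R) / Delta_min (alpha Pa))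
      * ln (delta^-1)
    + Num.sqrt delta * K%:R ^+ 3 * n%:R ^+ 2.
Proof.
move=> pmfA pmfC a1 a2 a3 a4 a5 alpha_decr _ chi_gt0 delta01.
have bandit : click_bandit Pa Pc by [].
have /andP[chi_max_gt0 _] := chi_max_itv bandit.
case: (lerP 1 (ln delta^-1)) => [logd_ge1|/ltW logd_le1].
  apply: le_trans (regret_le_potential bandit delta01 R0 n) _.
  rewrite lerD2r; set bound := (X in _ <= X).
  have Kchi_ge0 : 0 <= K%:R * chi_max (chi Pc) by rewrite mulr_ge0 // ltW.
  apply: le_trans (ler_wpM2l Kchi_ge0 (potential_init_le bandit delta01 R0 logd_ge1)) _.
  by rewrite le_eqVlt; apply/predU1P; left; rewrite /bound; ring.
apply: le_trans (regret_le_low_confidence bandit delta01 R0 n logd_le1) _.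
have /andP[Dmin_gt0 _] := Delta_min_itv bandit; have logd_gt0 := logd_gt0 delta01.
have V0_ge0 : 0 <= K%:R - 1 + 2 * #|Vset R0|%:R :> R.
  by rewrite addr_ge0 ?mulr_ge0 // subr_ge0 ler1n (K_gt0 bandit).
by rewrite lerDr !mulr_ge0 ?invr_ge0 // ltW.
Qed.
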